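(* Let $\mathfrak{X}$ be an abstract state space, $(\mathcal{U}(t))_{t\ge0}$ a substochastic $C_0$-semigroup on $\mathfrak{X}$ with generator $\mathcal{A}$, $\mathcal{B}:\mathscr{D}(\mathcal{A})\to\mathfrak{X}$ a positive linear operator with $\langle\mathbf{\Psi},(\mathcal{A}+\mathcal{B})u\rangle\le0$ for all $u\in\mathscr{D}(\mathcal{A})\cap\mathfrak{X}_+$, and let $(\mathcal{V}_n(t))_{t\ge0}$, $n\ge0$, be the associated Dyson–Phillips iterates. For any $\lambda>0$ and any $u\in\mathfrak{X}$, $$\lim_{t\to\infty}\ \sup_{n\in\mathbb{N}}\left\|\mathcal{B}\int_t^\infty\exp(-\lambda s)\mathcal{V}_n(s)u\,\mathrm{d}s\right\|=0.$$
   Context: An abstract state space is a real ordered Banach space $\mathfrak{X}$ whose positive cone $\mathfrak{X}_+$ is closed, generating ($\mathfrak{X}=\mathfrak{X}_+-\mathfrak{X}_+$), and on which the norm is additive: $\|u+v\|=\|u\|+\|v\|$ for $u,v\in\mathfrak{X}_+$. $\mathbf{\Psi}\in\mathfrak{X}^\star_+$ is the positive functional with $\langle\mathbf{\Psi},u\rangle=\|u\|$ for $u\in\mathfrak{X}_+$. A linear operator is positive if it maps positive elements of its domain into $\mathfrak{X}_+$. A $C_0$-semigroup $(T(t))_{t\ge0}$ is substochastic if each $T(t)$ is positive and $\|T(t)u\|\le\|u\|$ for $u\in\mathfrak{X}_+$. Dyson–Phillips iterates: $\mathcal{V}_0(t)=\mathcal{U}(t)$, and $\mathcal{V}_{n+1}(t)$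 is the unique bounded (positive) operator on $\mathfrak{X}$ with $\mathcal{V}_{n+1}(t)u=\int_0^t\mathcal{V}_n(t-s)\mathcal{B}\,\mathcal{U}(s)u\,\mathrm{d}s$ for $u\in\mathscr{D}(\mathcal{A})$, $t\ge0$, $n\ge0$; each $t\mapsto\mathcal{V}_n(t)$ is strongly continuous and bounded on $[0,\infty)$. The integrals $\int_t^\infty\exp(-\lambda s)\mathcal{V}_n(s)u\,\mathrm{d}s$ converge in the graph norm of $\mathcal{A}$ and thus belong to $\mathscr{D}(\mathcal{A})$. *)

(* Defs.v *)
From Stdlib Require Import Reals.
From Coquelicot Require Import Coquelicot.

Local Open Scope R_scope.

Record abstract_state_space (X : CompleteNormedModule R_AbsRing)
  (pos : X -> Prop) : Prop := {
  pos_zero : pos zero;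
  pos_plus : forall u v : X, pos u -> pos v -> pos (plus u v);
  pos_scal : forall (a : R) (u : X), 0 <= a -> pos u -> pos (scal a u);
  pos_proper : forall u : X, pos u -> pos (opp u) -> u = zero;
  pos_closed : closed pos;
  pos_generating :
    forall u : X, exists v w : X, pos v /\ pos w /\ u = minus v w;
  pos_norm_additive :
    forall u v : X, pos u -> pos v -> norm (plus u v) = norm u + norm v
}.

(* Such a functional is unique, since the cone is generating. *)
Definition is_norm_functional (X : CompleteNormedModule R_AbsRing)
  (pos : X -> Prop) (Psi : X -> R) : Prop :=
  is_linear (V := R_NormedModule) Psi /\
  (forall u : X, pos u -> 0 <= Psi u) /\
  (forall u : X, pos u -> Psi u = norm u).

(* Families indexed by t >= 0 are functions of t : R whose values at t < 0 are
   irrelevant. Coquelicot's [is_linear] includes boundedness. *)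
Record C0_semigroup (X : CompleteNormedModule R_AbsRing)
  (T : R -> X -> X) : Prop := {
  C0_linear : forall t : R, 0 <= t -> is_linear (T t);
  C0_zero : forall u : X, T 0 u = u;
  C0_plus : forall (s t : R) (u : X),
    0 <= s -> 0 <= t -> T (s + t) u = T s (T t u);
  C0_continuous : forall u : X,
    filterlim (fun t : R => T t u) (at_right 0) (locally u)
}.

Definition substochastic (X : CompleteNormedModule R_AbsRing)
  (pos : X -> Prop) (T : R -> X -> X) : Prop :=
  forall (t : R) (u : X), 0 <= t -> pos u ->
    pos (T t u) /\ norm (T t u) <= norm u.

(* An unbounded operator is a domain D : X -> Prop together with a function
   X -> X whose values outside D are irrelevant. *)
Definition is_generator (X : CompleteNormedModule R_AbsRing)
  (T : R -> X -> X) (D : X -> Prop) (A : X -> X) : Prop :=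
  forall u v : X,
    (D u /\ A u = v) <->
    filterlim (fun h : R => scal (/ h) (minus (T h u) u))
      (at_right 0) (locally v).

Definition linear_on (X : CompleteNormedModule R_AbsRing)
  (D : X -> Prop) (B : X -> X) : Prop :=
  (forall u v : X, D u -> D v -> B (plus u v) = plus (B u) (B v)) /\
  (forall (a : R) (u : X), D u -> B (scal a u) = scal a (B u)).

Definition positive_on (X : CompleteNormedModule R_AbsRing)
  (pos D : X -> Prop) (B : X -> X) : Prop :=
  forall u : X, D u -> pos u -> pos (B u).

(* V (S n) t is determined by its values on D, which is dense when D is the
   domain of the generator of U. *)
Record dyson_phillips (X : CompleteNormedModule R_AbsRing)
  (U : R -> X -> X) (D : X -> Prop) (B : X -> X)
  (V : nat -> R -> X -> X) : Prop := {
  dp_zero : forall (t : R) (u : X), 0 <= t -> V O t u = U t u;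
  dp_linear : forall (n : nat) (t : R), 0 <= t -> is_linear (V n t);
  dp_succ : forall (n : nat) (t : R) (u : X), 0 <= t -> D u ->
    is_RInt (fun s : R => V n (t - s) (B (U s u))) 0 t (V (S n) t u)
}.

Definition laplace_integrand (X : CompleteNormedModule R_AbsRing)
  (V : nat -> R -> X -> X) (lam : R) (u : X) (n : nat) (s : R) : X :=
  scal (exp (- lam * s)) (V n s u).

Definition laplace_tail (X : CompleteNormedModule R_AbsRing)
  (V : nat -> R -> X -> X) (lam : R) (u : X) (n : nat) (t : R) : X :=
  RInt_gen (laplace_integrand X V lam u n)
    (at_point t) (Rbar_locally p_infty).

(* Main.v *)
(* Put F_n u for the integral of exp(-lam s) V_n(s) u over [0,oo), R = F_0 for
   the resolvent of A, and L = B R. For u in the domain of A, the recursion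
   for V_{n+1} is split at an intermediate time; by density this gives
     V_n(t + s) = sum_{k<=n} V_k(t) V_{n-k}(s),
   so that the tail at t equals exp(-lam t) sum_{k<=n} F_k V_{n-k}(t) u.
   Differentiating this formula at t = 0 on the range of R gives
   F_{n+1} = F_n L, that is F_n = R L^n, whose range lies in the domain of A.
   The operator B maps the tail at t to
   exp(-lam t) sum_{k<=n} L^{k+1} V_{n-k}(t) u. For u in the cone,
   <Psi, (A + B) R u> <= 0 makes L contractive, and the recursion gives
   sum_{k<=n} |V_k(t) u| <= |u|; the supremum over n is thus at most
   exp(-lam t) |u|. General u are differences of elements of the cone; Baire's
   theorem bounds these elements by M |u|, which makes the V_n(t) uniformly
   bounded and L continuous. *)

Require Import Defs.
From Stdlib Require Import Reals Lra Lia List Classical IndefiniteDescription.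
From Coquelicot Require Import Coquelicot.

Local Open Scope R_scope.

(** * Linear identities in modules, by comparison of coefficients *)

(** [B] need not be bounded and is not assumed closed, so it cannot be moved under an integral or a
    limit. It is therefore applied only to finite sums of vectors in the range of the resolvent,
    where [B R = L] is continuous; this is why the tail is turned into a finite sum. The definition
    of the iterates contains no continuity in time, which the integrals require. For [v] in the
    cone, the bound on the sum gives [|V_(n+1)(h) v| <= |v| - |U(h) v|], hence continuity at [0],
    and the addition formula carries it to all later times. The bound itself is a balance: over
    [[0,t]] the norm lost along an orbit in the cone is minus the integral of [Psi (A U(s) u)]. This
    dominates the integral of [|B U(s) u|], which pays for all iterates of positive index together.
    Summability over the index, rather than a bound on each iterate, makes the final estimate
    uniform in [n]: the image of the tail is a convolution of contractions with a sequence of total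
    norm at most [|u|]. *)

Inductive mexpr : Type :=
| MVar (n : nat) | MZero | MPlus (a b : mexpr) | MOpp (a : mexpr)
| MScal (r : R) (a : mexpr).

Fixpoint mden {V : ModuleSpace R_Ring} (env : list V) (e : mexpr) : V :=
  match e with
  | MVar n => nth n env zero
  | MZero => zero
  | MPlus a b => plus (mden env a) (mden env b)
  | MOpp a => opp (mden env a)
  | MScal r a => scal r (mden env a)
  end.

Fixpoint mcoef (e : mexpr) (k : nat) : R :=
  match e with
  | MVar n => if Nat.eqb n k then 1 else 0
  | MZero => 0
  | MPlus a b => mcoef a k + mcoef b k
  | MOpp a => - mcoef a k
  | MScal r a => r * mcoef a k
  end.

Fixpoint mcomb {V : ModuleSpace R_Ring} (env : list V) (c : nat -> R) : V :=
  match env with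
  | nil => zero
  | x :: env => plus (scal (c O) x) (mcomb env (fun k => c (S k)))
  end.

(** The recursion on [env] makes this compute to a finite conjunction of real equations, one per
    variable, which [ring] or [field] can then close. *)
Fixpoint mcoef_eq {V : Type} (env : list V) (c d : nat -> R) : Prop :=
  match env with
  | nil => True
  | _ :: env =>
      c O = d O /\ mcoef_eq env (fun k => c (S k)) (fun k => d (S k))
  end.

Lemma mcomb_eq {V : ModuleSpace R_Ring} (env : list V) :
  forall c d, mcoef_eq env c d -> mcomb env c = mcomb env d.
Proof.
  induction env as [|x env IH]; simpl; intros c d; [easy|].
  intros [-> H]. now rewrite (IH _ _ H).
Qed.

Lemma mcomb_zero {V : ModuleSpace R_Ring} (env : list V) :
  forall c, (forall k, c k = 0) -> mcomb env c = zero.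
Proof.
  induction env as [|x env IH]; simpl; intros c Hc; [easy|].
  rewrite IH by (intros; apply Hc).
  rewrite Hc, plus_zero_r. apply (scal_zero_l (K := R_Ring)).
Qed.

Lemma mcomb_var {V : ModuleSpace R_Ring} (env : list V) :
  forall n c, (forall k, c k = if Nat.eqb n k then 1 else 0) ->
  mcomb env c = nth n env zero.
Proof.
  induction env as [|x env IH]; simpl; intros [|n] c Hc; try easy.
  - rewrite mcomb_zero by (intros k; rewrite Hc; easy).
    rewrite Hc. simpl. rewrite plus_zero_r. apply (scal_one (K := R_Ring)).
  - rewrite (IH n) by (intros k; rewrite Hc; easy).
    rewrite Hc. simpl. rewrite (scal_zero_l (K := R_Ring)).
    apply plus_zero_l.
Qed.

Lemma mcomb_plus {V : ModuleSpace R_Ring} (env : list V) :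
  forall c d, mcomb env (fun k => c k + d k) = plus (mcomb env c) (mcomb env d).
Proof.
  induction env as [|x env IH]; simpl; intros c d.
  - now rewrite plus_zero_l.
  - rewrite IH.
    change (scal (c O + d O) x) with (scal (@plus R_Ring (c O) (d O)) x).
    rewrite scal_distr_r.
    rewrite <- !plus_assoc. f_equal. rewrite !plus_assoc. f_equal.
    apply plus_comm.
Qed.

Lemma mcomb_scal {V : ModuleSpace R_Ring} (env : list V) (r : R) :
  forall c, mcomb env (fun k => r * c k) = scal r (mcomb env c).
Proof.
  induction env as [|x env IH]; simpl; intros c.
  - now rewrite (scal_zero_r (K := R_Ring)).
  - rewrite IH. rewrite (scal_distr_l (K := R_Ring)). f_equal.
    symmetry. apply (scal_assoc (K := R_Ring)).
Qed.

Lemma mden_comb {V : ModuleSpace R_Ring} (env : list V) (e : mexpr) :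
  mden env e = mcomb env (mcoef e).
Proof.
  induction e as [n| |a IHa b IHb|a IHa|r a IHa]; simpl.
  - symmetry. now apply mcomb_var.
  - symmetry. now apply mcomb_zero.
  - now rewrite IHa, IHb, <- mcomb_plus.
  - rewrite IHa. rewrite <- (scal_opp_one (K := R_Ring)).
    rewrite <- (mcomb_scal env (opp one)). apply mcomb_eq.
    generalize (mcoef a). clear.
    induction env as [|x env IH]; simpl; intros c; [easy|].
    split; [|apply (IH (fun k => c (S k)))].
    unfold opp, one; simpl. ring.
  - now rewrite IHa, <- mcomb_scal.
Qed.

Lemma mden_eq {V : ModuleSpace R_Ring} (env : list V) (a b : mexpr) :
  mcoef_eq env (mcoef a) (mcoef b) -> mden env a = mden env b.
Proof. intros H. rewrite !mden_comb. now apply mcomb_eq. Qed.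

Ltac mlookup x env :=
  lazymatch env with
  | x :: _ => constr:(O)
  | _ :: ?env => let n := mlookup x env in constr:(S n)
  end.

Ltac minsert x env :=
  lazymatch env with
  | context [x :: _] => env
  | _ => constr:(x :: env)
  end.

Ltac mvars t env :=
  lazymatch t with
  | plus ?a ?b => let env := mvars a env in mvars b env
  | minus ?a ?b => let env := mvars a env in mvars b env
  | opp ?a => mvars a env
  | scal _ ?a => mvars a env
  | zero => env
  | _ => minsert t env
  end.

Ltac mreify t env :=
  lazymatch t with
  | plus ?a ?b =>
      let a := mreify a env in let b := mreify b env in constr:(MPlus a b)
  | minus ?a ?b =>
      let a := mreify a env in let b := mreify b env in
      constr:(MPlus a (MOpp b))
  | opp ?a => let a := mreify a env in constr:(MOpp a)
  | scal ?r ?a => let a := mreify a env in constr:(MScal r a)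
  | zero => constr:(MZero)
  | _ => let n := mlookup t env in constr:(MVar n)
  end.

Ltac module_eq_with tac :=
  lazymatch goal with
  | |- @eq ?T ?a ?b =>
      let env := mvars a (@nil T) in
      let env := mvars b env in
      let ea := mreify a env in
      let eb := mreify b env in
      refine (mden_eq env ea eb _);
      cbn [mcoef_eq mcoef Nat.eqb]; repeat split; tac
  end.

Ltac module_eq := module_eq_with ltac:(try ring).

(** The match backtracks over the norms in the goal until it meets one whose argument equals [b] by
    comparison of coefficients. *)
Ltac norm_to_with b tac :=
  match goal with
  | |- context [@norm ?K ?V ?a] =>
      let H := fresh in
      assert (H : a = b) by (module_eq_with tac); rewrite H; clear H
  end.

Ltac norm_to b := norm_to_with b ltac:(try ring).

(** * Norms and limits *)

Section Limits.

Context {V : CompleteNormedModule R_AbsRing}.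

(* Coquelicot reaches the operations of a complete normed module along several
   convertible paths that [rewrite] and [lra] do not identify; restating its
   lemmas for [CompleteNormedModule] fixes one path. *)
Lemma norm_add_le (u v : V) : norm (plus u v) <= norm u + norm v.
Proof. apply (norm_triangle (V := V)). Qed.

Lemma norm_neg (u : V) : norm (opp u) = norm u.
Proof. apply (norm_opp (V := V)). Qed.

Lemma norm_null : norm (@zero V) = 0.
Proof. apply (norm_zero (V := V)). Qed.

Lemma norm_null_eq (u : V) : norm u = 0 -> u = @zero V.
Proof. apply (norm_eq_zero (V := V)). Qed.

Lemma filterlim_norm_iff {T : Type} (F : (T -> Prop) -> Prop) {FF : Filter F}
  (f : T -> V) (l : V) :
  filterlim f F (locally l) <->
  (forall eps : R, 0 < eps -> F (fun x => norm (minus (f x) l) < eps)).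
Proof.
  rewrite (filterlim_locally_ball_norm f l). split.
  - intros H eps Heps. exact (H (mkposreal eps Heps)).
  - intros H eps. apply H, cond_pos.
Qed.

Lemma norm_le_filterlim {T : Type} (F : (T -> Prop) -> Prop)
  {FF : ProperFilter F} (f : T -> V) (l : V) (C : R) :
  filterlim f F (locally l) -> F (fun x => norm (f x) <= C) -> norm l <= C.
Proof.
  intros Hl HC. apply Rnot_lt_le; intros Hlt.
  assert (He : 0 < norm l - C) by lra.
  destruct (filter_ex _ (filter_and _ _ HC
    (proj1 (filterlim_norm_iff F f l) Hl _ He))) as [x [H1 H2]].
  pose proof (norm_add_le (f x) (minus l (f x))) as H.
  replace (plus (f x) (minus l (f x))) with l in H by module_eq.
  replace (minus l (f x)) with (opp (minus (f x) l)) in H by module_eq.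
  rewrite norm_neg in H. lra.
Qed.

Lemma filterlim_fun_unique {T : Type} (F : (T -> Prop) -> Prop)
  {FF : ProperFilter F} (f : T -> V) (l l' : V) :
  filterlim f F (locally l) -> filterlim f F (locally l') -> l = l'.
Proof. apply (filterlim_locally_unique (V := V)). Qed.

Lemma filterlim_plus_fun {T : Type} (F : (T -> Prop) -> Prop)
  {FF : Filter F} (f g : T -> V) (a b : V) :
  filterlim f F (locally a) -> filterlim g F (locally b) ->
  filterlim (fun x => plus (f x) (g x)) F (locally (plus a b)).
Proof.
  intros Hf Hg. eapply filterlim_comp_2; [exact Hf|exact Hg|].
  apply (filterlim_plus (V := V)).
Qed.

Lemma filterlim_scal_fun {T : Type} (F : (T -> Prop) -> Prop)
  {FF : Filter F} (k : R) (f : T -> V) (a : V) :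
  filterlim f F (locally a) ->
  filterlim (fun x => scal k (f x)) F (locally (scal k a)).
Proof.
  intros Hf. eapply filterlim_comp; [exact Hf|].
  apply (filterlim_scal_r (K := R_AbsRing) (V := V) k a).
Qed.

Lemma filterlim_minus_fun {T : Type} (F : (T -> Prop) -> Prop)
  {FF : Filter F} (f g : T -> V) (a b : V) :
  filterlim f F (locally a) -> filterlim g F (locally b) ->
  filterlim (fun x => minus (f x) (g x)) F (locally (minus a b)).
Proof.
  intros Hf Hg.
  refine (filterlim_plus_fun F f (fun x => opp (g x)) _ _ Hf _).
  eapply filterlim_comp; [exact Hg|]. apply (filterlim_opp (V := V)).
Qed.

Lemma norm_sub_le (u v : V) : norm (minus u v) <= norm u + norm v.
Proof.
  unfold minus. rewrite <- (norm_neg v). apply norm_add_le.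
Qed.

Lemma norm_sub_sym (u v : V) : norm (minus u v) = norm (minus v u).
Proof. rewrite <- norm_neg. f_equal. module_eq. Qed.

Lemma norm_sub_triangle (u v w : V) :
  norm (minus u w) <= norm (minus u v) + norm (minus v w).
Proof.
  replace (minus u w) with (plus (minus u v) (minus v w)) by module_eq.
  apply norm_add_le.
Qed.

(** [norm_scal] is an inequality; applied to [/ a] and [scal a u], it gives the reverse one. *)
Lemma norm_scal_pos (a : R) (u : V) : 0 <= a -> norm (scal a u) = a * norm u.
Proof.
  intros Ha.
  assert (Hle : forall (b : R) (v : V), 0 <= b -> norm (scal b v) <= b * norm v).
  { intros b v Hb. eapply Rle_trans; [apply (norm_scal (V := V) b v)|].
    right. unfold abs; simpl. now rewrite Rabs_pos_eq. }
  apply Rle_antisym; [now apply Hle|].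
  destruct (Req_dec a 0) as [->|Ha0].
  { rewrite Rmult_0_l. apply norm_ge_0. }
  assert (Hi : 0 < / a) by (apply Rinv_0_lt_compat; lra).
  pose proof (Hle (/ a) (scal a u) ltac:(lra)) as H.
  replace (scal (/ a) (scal a u)) with u in H
    by (module_eq_with ltac:(try (field; lra))).
  apply Rmult_le_compat_l with (r := a) in H; [|lra].
  replace (a * (/ a * norm (scal a u))) with (norm (scal a u)) in H
    by (field; lra).
  exact H.
Qed.

Lemma norm_sum_n_le (a : nat -> V) (n : nat) :
  norm (sum_n a n) <= sum_n (fun k => norm (a k)) n.
Proof.
  induction n as [|n IH].
  - rewrite !sum_O. lra.
  - rewrite !sum_Sn. eapply Rle_trans; [apply norm_add_le|].
    now apply Rplus_le_compat_r.
Qed.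

End Limits.

(** * Bounded decompositions *)

Section Decomposition.

Context {X : CompleteNormedModule R_AbsRing} {pos : X -> Prop}
  (hX : abstract_state_space X pos).

Let decomposable (c : R) (u : X) : Prop :=
  exists v w : X, pos v /\ pos w /\ u = minus v w /\ norm v + norm w <= c.

Lemma decomposable_plus (c d : R) (u v : X) :
  decomposable c u -> decomposable d v -> decomposable (c + d) (plus u v).
Proof.
  intros (v1 & w1 & Hv1 & Hw1 & -> & H1) (v2 & w2 & Hv2 & Hw2 & -> & H2).
  exists (plus v1 v2), (plus w1 w2). repeat split.
  - now apply (pos_plus _ _ hX).
  - now apply (pos_plus _ _ hX).
  - module_eq.
  - pose proof (norm_add_le v1 v2). pose proof (norm_add_le w1 w2). lra.
Qed.

Lemma decomposable_opp (c : R) (u : X) :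
  decomposable c u -> decomposable c (opp u).
Proof.
  intros (v & w & Hv & Hw & -> & H). exists w, v. repeat split; auto.
  - module_eq.
  - lra.
Qed.

Lemma decomposable_scal (a c : R) (u : X) :
  0 <= a -> decomposable c u -> decomposable (a * c) (scal a u).
Proof.
  intros Ha (v & w & Hv & Hw & -> & H). exists (scal a v), (scal a w).
  repeat split.
  - now apply (pos_scal _ _ hX).
  - now apply (pos_scal _ _ hX).
  - module_eq.
  - rewrite !norm_scal_pos by easy. rewrite <- Rmult_plus_distr_l.
    now apply Rmult_le_compat_l.
Qed.

Lemma decomposable_le (c d : R) (u : X) :
  c <= d -> decomposable c u -> decomposable d u.
Proof.
  intros Hcd (v & w & Hv & Hw & Hu & H). exists v, w. repeat split; auto; lra.
Qed.

(* Baire's argument: otherwise nested balls avoiding the vectors with a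
   decomposition of size n shrink to a vector with no decomposition. *)
Lemma decomposable_somewhere_dense :
  exists (n : nat) (x0 : X) (r : R), 0 < r /\
    forall (y : X) (eps : R), norm (minus y x0) < r -> 0 < eps ->
    exists a : X, norm (minus a y) < eps /\ decomposable (INR n) a.
Proof.
  apply NNPP; intros Hno.
  assert (Hstep : forall (n : nat) (p : X * posreal), exists q : X * posreal,
    (forall a : X, norm (minus a (fst q)) <= snd q ->
       norm (minus a (fst p)) < snd p /\ ~ decomposable (INR n) a) /\
    snd q <= snd p / 2).
  { intros n [x r]; simpl. apply NNPP; intros Hn. apply Hno.
    exists n, x, r. split; [apply cond_pos|]. intros y eps Hy Heps.
    apply NNPP; intros Ha. apply Hn.
    (* The half turns weak inequalities into strict ones: the closed ball of radius [s] about [y]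
       lies in the open balls of radius [r] about [x] and [eps] about [y]. It also halves the
       radius. *)
    set (s := Rmin eps (r - norm (minus y x)) / 2).
    assert (Hs : 0 < Rmin eps (r - norm (minus y x)))
      by (apply Rmin_pos; lra).
    pose proof (Rmin_l eps (r - norm (minus y x))).
    pose proof (Rmin_r eps (r - norm (minus y x))).
    assert (Hs0 : 0 < s) by (unfold s; lra).
    exists (y, mkposreal s Hs0); simpl. split.
    - intros a Hay. split.
      + pose proof (norm_sub_triangle a y x). unfold s in Hay. lra.
      + intros Hda. apply Ha. exists a. split; [unfold s in Hay; lra|easy].
    - unfold s. pose proof (norm_ge_0 (minus y x)). lra. }
  assert (Hseq : exists q : nat -> X * posreal, forall n,
    (forall a : X, norm (minus a (fst (q (S n)))) <= snd (q (S n)) ->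
       norm (minus a (fst (q n))) < snd (q n) /\ ~ decomposable (INR n) a) /\
    snd (q (S n)) <= snd (q n) / 2).
  { destruct (functional_choice (fun np q => _) (fun np => Hstep (fst np) (snd np)))
      as [f Hf].
    exists (nat_rect _ (zero, mkposreal 1 Rlt_0_1) (fun n p => f (n, p))).
    intros n; simpl.
    exact (Hf (n, nat_rect _ (zero, mkposreal 1 Rlt_0_1)
                    (fun n p => f (n, p)) n)). }
  destruct Hseq as [q Hq].
  assert (Hnest : forall N m (a : X),
    norm (minus a (fst (q (m + N)%nat))) <= snd (q (m + N)%nat) ->
    norm (minus a (fst (q N))) <= snd (q N)).
  { intros N m; induction m as [|m IH]; simpl; intros a Ha; [easy|].
    apply IH. left. now apply (Hq (m + N)%nat). }
  assert (Hin : forall N m,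
    norm (minus (fst (q (m + N)%nat)) (fst (q N))) <= snd (q N)).
  { intros N m. apply (Hnest N m).
    replace (minus _ _) with (@zero X) by module_eq.
    rewrite norm_null. left; apply cond_pos. }
  assert (Hr : forall n, snd (q n) <= snd (q O) * (/ 2) ^ n).
  { induction n as [|n IH]; simpl; [lra|].
    destruct (Hq n) as [_ H]. lra. }
  assert (Hlim : exists x : X,
    filterlim (fun n => fst (q n)) eventually (locally x)).
  { apply (filterlim_locally_cauchy (U := X) (F := eventually)). intros eps.
    assert (He : 0 < eps / (2 * snd (q O))).
    { apply Rdiv_lt_0_compat; [apply cond_pos|].
      pose proof (cond_pos (snd (q O))). lra. }
    destruct (pow_lt_1_zero (/ 2) ltac:(rewrite Rabs_pos_eq; lra) _ He)
      as [N HN].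
    exists (fun n => (N <= n)%nat). split; [now exists N|].
    intros n m Hn Hm. apply (norm_compat1 (V := X)).
    assert (HN' : 2 * snd (q N) < eps).
    { specialize (HN N (Nat.le_refl _)).
      rewrite Rabs_pos_eq in HN by (apply pow_le; lra).
      pose proof (cond_pos (snd (q O))) as Hq0.
      apply Rmult_lt_compat_l with (r := 2 * snd (q O)) in HN; [|lra].
      replace (2 * snd (q O) * (eps / (2 * snd (q O)))) with (pos_div_2 eps * 2)
        in HN by (simpl; field; lra).
      simpl in HN. specialize (Hr N). lra. }
    replace n with (n - N + N)%nat by lia.
    replace m with (m - N + N)%nat by lia.
    pose proof (norm_sub_triangle (fst (q (m - N + N)%nat)) (fst (q N))
      (fst (q (n - N + N)%nat))) as H.
    rewrite (norm_sub_sym (fst (q N))) in H.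
    pose proof (Hin N (n - N)%nat). pose proof (Hin N (m - N)%nat).
    eapply Rle_lt_trans; [exact H|]. lra. }
  destruct Hlim as [x Hx].
  assert (Hxin : forall N, norm (minus x (fst (q N))) <= snd (q N)).
  { intros N.
    apply (norm_le_filterlim eventually
      (fun n => minus (fst (q n)) (fst (q N)))).
    - apply (filterlim_minus_fun eventually); [exact Hx|apply filterlim_const].
    - exists N. intros n Hn. replace n with (n - N + N)%nat by lia.
      apply Hin. }
  destruct (pos_generating _ _ hX x) as (v & w & Hv & Hw & Hxvw).
  destruct (nfloor_ex (norm v + norm w)) as [n [_ Hn]].
  { pose proof (norm_ge_0 v). pose proof (norm_ge_0 w). lra. }
  (* The decomposition of [x] has size below [INR n + 1], whereas the ball of index [S (S n)], which
     contains [x], avoids the vectors with a decomposition of size [INR (S n)]. *)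
  destruct (Hq (S n)) as [H _].
  destruct (H x (Hxin (S (S n)))) as [_ Hnd].
  apply Hnd. exists v, w. repeat split; auto. rewrite S_INR. lra.
Qed.

(** Approximations of [x0 + s y] and of [x0] differ by an approximation of [s y], so the centre [x0]
    drops out. Density near one point thus serves every vector, with a size proportional to its
    norm. *)
Lemma decomposable_half :
  exists K : R, 0 < K /\ forall y : X, exists a : X,
    norm (minus y a) <= norm y / 2 /\ decomposable (K * norm y) a.
Proof.
  destruct decomposable_somewhere_dense as (n & x0 & r & Hr & Hd).
  assert (Hn := pos_INR n).
  (* Two decompositions of size [INR n] are multiplied by [/ s = 2 |y| / r]; the summand [1] keeps
     the constant positive when [n] is [0]. *)
  exists ((2 * INR n + 1) * 2 / r).
  split; [apply Rdiv_lt_0_compat; lra|].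
  intros y. destruct (Req_dec (norm y) 0) as [Hy|Hy].
  { exists (@zero X). apply norm_null_eq in Hy. subst y. split.
    - replace (minus (@zero X) (@zero X)) with (@zero X) by module_eq.
      rewrite norm_null. lra.
    - exists (@zero X), (@zero X). repeat split; try apply (pos_zero _ _ hX).
      + module_eq.
      + rewrite norm_null. lra. }
  assert (Hy0 : 0 < norm y) by (pose proof (norm_ge_0 y); lra).
  set (s := r / (2 * norm y)).
  assert (Hs : 0 < s) by (apply Rdiv_lt_0_compat; lra).
  (* Two errors of a quarter of [s |y|] become half of [|y|] after division by [s]. *)
  assert (Heps : 0 < s * norm y / 4) by (apply Rdiv_lt_0_compat; [nra|lra]).
  destruct (fun H => Hd (plus x0 (scal s y)) _ H Heps) as (a & Ha & Hda).
  { replace (minus _ _) with (scal s y) by module_eq.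
    rewrite norm_scal_pos by lra. unfold s.
    replace (r / (2 * norm y) * norm y) with (r / 2) by (field; lra). lra. }
  destruct (fun H => Hd x0 _ H Heps) as (b & Hb & Hdb).
  { replace (minus _ _) with (@zero X) by module_eq.
    rewrite norm_null. lra. }
  exists (scal (/ s) (minus a b)).
  assert (Hs' : 0 < / s) by now apply Rinv_0_lt_compat.
  split.
  - replace (minus y (scal (/ s) (minus a b))) with
      (scal (/ s) (minus (minus b x0) (minus a (plus x0 (scal s y)))))
      by (module_eq_with ltac:(try (field; lra))).
    rewrite norm_scal_pos by lra.
    pose proof (norm_sub_le (minus b x0) (minus a (plus x0 (scal s y)))) as H.
    apply Rle_trans with (/ s * (s * norm y / 4 + s * norm y / 4)).
    + apply Rmult_le_compat_l; lra.
    + right. field. lra.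
  - apply decomposable_le with (/ s * (INR n + INR n)).
    + unfold s. apply Rle_trans with ((2 * INR n) * 2 / r * norm y).
      * right. field. lra.
      * apply Rmult_le_compat_r; [lra|]. unfold Rdiv.
        apply Rmult_le_compat_r; [left; now apply Rinv_0_lt_compat|lra].
    + apply decomposable_scal; [lra|].
      apply decomposable_plus; [easy|now apply decomposable_opp].
Qed.

Lemma pos_sum_n (a : nat -> X) (n : nat) :
  (forall k, (k <= n)%nat -> pos (a k)) -> pos (sum_n a n).
Proof.
  induction n as [|n IH]; intros H.
  - rewrite sum_O. now apply H.
  - rewrite sum_Sn. apply (pos_plus _ _ hX); [apply IH; auto|now apply H].
Qed.

Lemma pos_filterlim {T : Type} (F : (T -> Prop) -> Prop) {FF : ProperFilter F}
  (f : T -> X) (l : X) :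
  filterlim f F (locally l) -> F (fun x => pos (f x)) -> pos l.
Proof.
  intros Hl Hp. now apply (closed_filterlim_loc f pos l Hl Hp), (pos_closed _ _ hX).
Qed.

(** The halving step is iterated on its own remainder, as in the open mapping theorem. The
    remainders decay like [(/ 2) ^ k], so the positive and the negative parts form two absolutely
    convergent series, each of sum at most [2 K |u|] in norm; hence the factor [4 * K]. *)
Lemma bounded_decomposition :
  exists M : R, 0 < M /\ forall u : X, exists v w : X,
    pos v /\ pos w /\ u = minus v w /\ norm v + norm w <= M * norm u.
Proof.
  destruct decomposable_half as (K & HK & Hhalf).
  exists (4 * K). split; [lra|]. intros u.
  assert (Hdec : forall y : X, exists p : X * X, pos (fst p) /\ pos (snd p) /\
    norm (minus y (minus (fst p) (snd p))) <= norm y / 2 /\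
    norm (fst p) + norm (snd p) <= K * norm y).
  { intros y. destruct (Hhalf y) as (a & Ha & v & w & Hv & Hw & -> & Hn).
    now exists (v, w). }
  destruct (functional_choice _ Hdec) as [f Hf]. clear Hdec Hhalf.
  pose (y := nat_rect (fun _ => X) u
    (fun _ y => minus y (minus (fst (f y)) (snd (f y))))).
  pose (v := fun k => fst (f (y k))). pose (w := fun k => snd (f (y k))).
  assert (HyS : forall k, y (S k) = minus (y k) (minus (v k) (w k)))
    by reflexivity.
  assert (Hy : forall k, norm (y k) <= norm u * (/ 2) ^ k).
  { induction k as [|k IH]; simpl; [lra|].
    destruct (Hf (y k)) as (_ & _ & H & _). unfold y in *; simpl in *. lra. }
  assert (Hv : forall k, pos (v k)) by (intros k; apply (Hf (y k))).
  assert (Hw : forall k, pos (w k)) by (intros k; apply (Hf (y k))).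
  assert (Hvw : forall k,
    norm (v k) + norm (w k) <= K * norm u * (/ 2) ^ k).
  { intros k. destruct (Hf (y k)) as (_ & _ & _ & H).
    eapply Rle_trans; [exact H|]. rewrite Rmult_assoc.
    apply Rmult_le_compat_l; [lra|apply Hy]. }
  assert (Hg : is_series (fun k => K * norm u * (/ 2) ^ k) (K * norm u * 2)).
  { replace (K * norm u * 2) with (K * norm u * / (1 - / 2)) by field.
    apply (is_series_scal (K := R_AbsRing) (V := R_NormedModule)
      (K * norm u) (fun k => (/ 2) ^ k)).
    apply is_series_geom. rewrite Rabs_pos_eq; lra. }
  assert (Hex : forall a : nat -> X,
    (forall k, norm (a k) <= K * norm u * (/ 2) ^ k) ->
    exists l : X, filterlim (sum_n a) eventually (locally l) /\
      norm l <= K * norm u * 2).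
  { intros a Ha. destruct (ex_series_le a _ Ha) as [l Hl].
    { now exists (K * norm u * 2). }
    exists l. split; [exact Hl|].
    apply (norm_le_filterlim eventually (sum_n a)); [exact Hl|].
    exists O. intros n _. eapply Rle_trans; [apply norm_sum_n_le|].
    apply Rle_trans with (sum_n (fun k => K * norm u * (/ 2) ^ k) n).
    - clear -Ha. induction n as [|n IH]; [rewrite !sum_O; apply Ha|].
      rewrite !sum_Sn. apply Rplus_le_compat; [easy|apply Ha].
    - apply (is_lim_seq_incr_compare
        (sum_n (fun k => K * norm u * (/ 2) ^ k)) (K * norm u * 2)).
      + exact Hg.
      + intros k. rewrite sum_Sn.
        assert (0 <= K * norm u * (/ 2) ^ S k).
        { eapply Rle_trans; [|apply Ha]. apply norm_ge_0. }
        unfold plus; simpl in *. lra. }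
  destruct (Hex v) as (V & HV & HVn).
  { intros k. pose proof (norm_ge_0 (w k)). specialize (Hvw k). lra. }
  destruct (Hex w) as (W & HW & HWn).
  { intros k. pose proof (norm_ge_0 (v k)). specialize (Hvw k). lra. }
  exists V, W. repeat split.
  - apply (pos_filterlim eventually (sum_n v)); [exact HV|].
    exists O. intros n _. now apply pos_sum_n.
  - apply (pos_filterlim eventually (sum_n w)); [exact HW|].
    exists O. intros n _. now apply pos_sum_n.
  (* The sums telescope: what they miss of [u] is the remainder, which tends to zero. *)
  - assert (Hsum : forall n, minus (sum_n v n) (sum_n w n) = minus u (y (S n))).
    { induction n as [|n IH].
      - rewrite !sum_O, HyS. change (y O) with u. module_eq.
      - rewrite !sum_Sn, (HyS (S n)).
        replace (minus u (minus (y (S n)) (minus (v (S n)) (w (S n))))) with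
          (plus (minus u (y (S n))) (minus (v (S n)) (w (S n)))) by module_eq.
        rewrite <- IH. module_eq. }
    apply (filterlim_fun_unique eventually
      (fun n => minus (sum_n v n) (sum_n w n))).
    + apply filterlim_norm_iff; [typeclasses eauto|]. intros eps Heps.
      assert (He : 0 < eps / (norm u + 1)).
      { apply Rdiv_lt_0_compat; [easy|]. pose proof (norm_ge_0 u). lra. }
      destruct (pow_lt_1_zero (/ 2) ltac:(rewrite Rabs_pos_eq; lra) _ He)
        as [N HN].
      exists N. intros n Hn. rewrite Hsum.
      replace (minus (minus u (y (S n))) u) with (opp (y (S n))) by module_eq.
      rewrite norm_neg. eapply Rle_lt_trans; [apply Hy|].
      specialize (HN (S n) ltac:(lia)).
      rewrite Rabs_pos_eq in HN by (apply pow_le; lra).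
      pose proof (norm_ge_0 u).
      apply Rle_lt_trans with ((norm u + 1) * (/ 2) ^ S n).
      * apply Rmult_le_compat_r; [apply pow_le|]; lra.
      * apply Rmult_lt_compat_l with (r := norm u + 1) in HN; [|lra].
        replace ((norm u + 1) * (eps / (norm u + 1))) with eps in HN
          by (field; lra).
        exact HN.
    + now apply (filterlim_minus_fun eventually).
  - lra.
Qed.

(** Only compatibility with differences is asked of [T], so that the bound can serve to prove
    continuity, as it does for [L]. *)
Lemma cone_bound_extends (T : X -> X) (M : R) :
  (forall u : X, exists v w : X, pos v /\ pos w /\ u = minus v w /\
     norm v + norm w <= M * norm u) ->
  (forall v w : X, T (minus v w) = minus (T v) (T w)) ->
  (forall v : X, pos v -> norm (T v) <= norm v) ->
  forall u : X, norm (T u) <= M * norm u.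
Proof.
  intros HM Hlin Hpos u. destruct (HM u) as (v & w & Hv & Hw & -> & H).
  rewrite Hlin. eapply Rle_trans; [apply norm_sub_le|].
  specialize (Hpos v Hv) as H1. specialize (Hpos w Hw) as H2. lra.
Qed.

End Decomposition.

(** * Integrals of vector-valued functions *)

Lemma Riemann_sum_linear {X Y : NormedModule R_AbsRing} (T : X -> Y)
  (f : R -> X) (ptd : SF_seq) :
  is_linear T -> Riemann_sum (fun s => T (f s)) ptd = T (Riemann_sum f ptd).
Proof.
  intros HT. induction ptd as [x0|h ptd IH] using SF_cons_ind.
  - unfold Riemann_sum; simpl. symmetry. exact (linear_zero T HT).
  - rewrite !Riemann_sum_cons, IH. symmetry.
    etransitivity; [apply (linear_plus _ HT)|]. f_equal.
    apply (linear_scal _ HT).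
Qed.

Lemma is_RInt_linear {X Y : NormedModule R_AbsRing} (T : X -> Y)
  (f : R -> X) (a b : R) (l : X) :
  is_linear T -> is_RInt f a b l -> is_RInt (fun s => T (f s)) a b (T l).
Proof.
  intros HT Hf. unfold is_RInt.
  apply filterlim_ext with
    (fun ptd => T (scal (sign (b - a)) (Riemann_sum f ptd))).
  - intros ptd. rewrite (Riemann_sum_linear T f ptd HT).
    apply (linear_scal _ HT).
  - eapply filterlim_comp; [exact Hf|]. now apply linear_cont.
Qed.

Lemma filterlim_sum_n {V : NormedModule R_AbsRing} {T : Type}
  (F : (T -> Prop) -> Prop) {FF : Filter F} (f : nat -> T -> V) (l : nat -> V)
  (n : nat) :
  (forall k, (k <= n)%nat -> filterlim (f k) F (locally (l k))) ->
  filterlim (fun x => sum_n (fun k => f k x) n) F (locally (sum_n l n)).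
Proof.
  induction n as [|n IH]; intros H.
  - rewrite sum_O. apply filterlim_ext with (f O).
    + intros x. now rewrite sum_O.
    + now apply H.
  - rewrite sum_Sn.
    apply filterlim_ext with
      (fun x => plus (sum_n (fun k => f k x) n) (f (S n) x)).
    + intros x. now rewrite sum_Sn.
    + eapply filterlim_comp_2; [apply IH; auto|now apply H|].
      apply filterlim_plus.
Qed.

Lemma is_RInt_sum_n {V : NormedModule R_AbsRing} (f : nat -> R -> V)
  (a b : R) (l : nat -> V) (n : nat) :
  (forall k, (k <= n)%nat -> is_RInt (f k) a b (l k)) ->
  is_RInt (fun s => sum_n (fun k => f k s) n) a b (sum_n l n).
Proof.
  induction n as [|n IH]; intros H.
  - rewrite sum_O. apply is_RInt_ext with (f O).
    + intros x _. now rewrite sum_O.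
    + now apply H.
  - rewrite sum_Sn.
    apply is_RInt_ext with
      (fun x => plus (sum_n (fun k => f k x) n) (f (S n) x)).
    + intros x _. now rewrite sum_Sn.
    + apply is_RInt_plus; [apply IH; auto|now apply H].
Qed.

Lemma sum_n_shift {G : AbelianMonoid} (a : nat -> G) (n : nat) :
  sum_n a (S n) = plus (a O) (sum_n (fun k => a (S k)) n).
Proof.
  unfold sum_n. rewrite sum_n_m_S. apply sum_Sn_m. lia.
Qed.

Lemma sum_n_rev {G : AbelianMonoid} (a : nat -> G) (n : nat) :
  sum_n (fun k => a (n - k)%nat) n = sum_n a n.
Proof.
  induction n as [|n IH]; [now rewrite !sum_O|].
  rewrite sum_n_shift, sum_Sn, plus_comm. f_equal.
  rewrite <- IH. apply sum_n_ext. intros k. now f_equal.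
Qed.

Lemma sum_n_le (a b : nat -> R) (n : nat) :
  (forall k, (k <= n)%nat -> a k <= b k) -> sum_n a n <= sum_n b n.
Proof.
  induction n as [|n IH]; intros H.
  - rewrite !sum_O. now apply H.
  - rewrite !sum_Sn. apply Rplus_le_compat; [apply IH; auto|now apply H].
Qed.

Lemma is_RInt_shift {V : NormedModule R_AbsRing} (f : R -> V) (c a b : R)
  (l : V) :
  is_RInt f (c + a) (c + b) l -> is_RInt (fun s => f (c + s)) a b l.
Proof.
  intros H. apply is_RInt_ext with (fun s => scal 1 (f (1 * s + c))).
  - intros x _. rewrite Rmult_1_l, Rplus_comm.
    apply (scal_one (K := R_Ring)).
  - apply is_RInt_comp_lin. now rewrite !Rmult_1_l, !(Rplus_comm _ c).
Qed.

Section Calculus.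

Context {X : CompleteNormedModule R_AbsRing}.

(** The modulus [w] does not depend on the starting point, so it controls left increments too, by
    exchanging the two times. Freezing the value at [0] for negative times gives an integrand
    continuous on the whole line. *)
Lemma continuous_half_line (f : R -> X) (w : R -> R) :
  filterlim w (at_right 0) (locally 0) ->
  (forall s h, 0 <= s -> 0 < h -> norm (minus (f (s + h)) (f s)) <= w h) ->
  forall t, continuous (fun t => f (Rmax 0 t)) t.
Proof.
  intros Hw Hf t. apply filterlim_norm_iff; [typeclasses eauto|].
  intros eps Heps.
  destruct (proj1 (filterlim_locally w 0) Hw (mkposreal eps Heps))
    as [delta Hd].
  exists delta. intros s Hs. change (Rabs (s - t) < delta) in Hs.
  assert (Hmain : forall p q, 0 <= p -> p < q -> q - p < delta ->
    norm (minus (f q) (f p)) < eps).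
  { intros p q Hp Hpq Hlt. replace q with (p + (q - p)) by ring.
    eapply Rle_lt_trans; [apply Hf; lra|].
    assert (Hb : ball 0 delta (q - p)).
    { change (Rabs (q - p - 0) < delta). rewrite Rminus_0_r, Rabs_pos_eq; lra. }
    specialize (Hd _ Hb ltac:(lra)).
    change (Rabs (w (q - p) - 0) < eps) in Hd.
    rewrite Rminus_0_r in Hd. eapply Rle_lt_trans; [apply Rle_abs|exact Hd]. }
  apply Rabs_def2 in Hs.
  assert (Ha := Rmax_l 0 s). assert (Hb := Rmax_l 0 t).
  destruct (Rtotal_order (Rmax 0 s) (Rmax 0 t)) as [H|[H|H]].
  - rewrite norm_sub_sym. apply Hmain; auto.
    unfold Rmax in *; destruct (Rle_dec 0 s); destruct (Rle_dec 0 t); lra.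
  - rewrite H. replace (minus _ _) with (@zero X) by module_eq.
    now rewrite norm_null.
  - apply Hmain; auto.
    unfold Rmax in *; destruct (Rle_dec 0 s); destruct (Rle_dec 0 t); lra.
Qed.

Lemma is_RInt_continuous (f : R -> X) (a b : R) :
  (forall t, continuous f t) -> is_RInt f a b (RInt f a b).
Proof.
  intros Hf. apply (RInt_correct (V := X)), (ex_RInt_continuous (V := X)).
  auto.
Qed.

Lemma sum_n_minus (a b : nat -> X) (n : nat) :
  sum_n (fun k => minus (a k) (b k)) n = minus (sum_n a n) (sum_n b n).
Proof.
  induction n as [|n IH]; [now rewrite !sum_O|].
  rewrite !sum_Sn, IH. module_eq.
Qed.

Lemma is_RInt_value (f : R -> X) (a b : R) (l l' : X) :
  l = l' -> is_RInt f a b l -> is_RInt f a b l'.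
Proof. now intros ->. Qed.

Lemma filterlim_value {T : Type} (F : (T -> Prop) -> Prop) (f : T -> X)
  (l l' : X) :
  l = l' -> filterlim f F (locally l) -> filterlim f F (locally l').
Proof. now intros ->. Qed.

Lemma is_derive_primitive (f : R -> X) (a t : R) :
  (forall t, continuous f t) -> is_derive (fun t => RInt f a t) t (f t).
Proof.
  intros Hf. apply (is_derive_RInt (V := X) f _ a); [|apply Hf].
  apply filter_forall. intros s. now apply is_RInt_continuous.
Qed.

Lemma is_derive_quotient (f : R -> X) (t : R) (l : X) :
  is_derive f t l ->
  filterlim (fun h => scal (/ h) (minus (f (t + h)) (f t)))
    (at_right 0) (locally l).
Proof.
  intros [_ Hd]. apply filterlim_norm_iff; [typeclasses eauto|].
  intros eps Heps.
  assert (He2 : 0 < eps / 2) by lra.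
  destruct (Hd t (fun P H => H) (mkposreal _ He2)) as [delta Hdelta].
  exists delta. intros h Hh Hh0.
  change R in (type of h). change (Rabs (h - 0) < delta) in Hh.
  assert (Hb : ball t delta (t + h)).
  { change (Rabs (t + h - t) < delta). now replace (t + h - t) with (h - 0) by ring. }
  specialize (Hdelta _ Hb).
  change (norm (minus (minus (f (t + h)) (f t)) (scal (t + h - t) l))
    <= eps / 2 * Rabs (t + h - t)) in Hdelta.
  assert (Eh : (t + h - t)%R = h) by (simpl; ring).
  rewrite Eh in Hdelta.
  rewrite Rabs_pos_eq in Hdelta by lra.
  norm_to_with (scal (/ h) (minus (minus (f (t + h)) (f t)) (scal h l)))
    ltac:(try (field; lra)).
  assert (Hi : 0 < / h) by now apply Rinv_0_lt_compat.
  rewrite norm_scal_pos by lra.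
  apply Rle_lt_trans with (/ h * (eps / 2 * h)).
  - apply Rmult_le_compat_l; [lra|exact Hdelta].
  - replace (/ h * (eps / 2 * h)) with (eps / 2) by (field; lra). lra.
Qed.

Lemma norm_filterlim {T : Type} (F : (T -> Prop) -> Prop) {FF : Filter F}
  (f : T -> X) (l : X) :
  filterlim f F (locally l) ->
  filterlim (fun x => norm (f x)) F (locally (norm l)).
Proof.
  intros H. eapply filterlim_comp; [exact H|]. apply (filterlim_norm (V := X)).
Qed.

Lemma linear_filterlim {Y : NormedModule R_AbsRing} (L : X -> Y) {T : Type}
  (F : (T -> Prop) -> Prop) {FF : Filter F} (f : T -> X) (l : X) :
  is_linear L ->
  filterlim f F (locally l) -> filterlim (fun x => L (f x)) F (locally (L l)).
Proof.
  intros HL H. eapply filterlim_comp; [exact H|].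
  exact (linear_cont L l HL).
Qed.

Lemma filterlim_le_R {T : Type} (F : (T -> Prop) -> Prop) {FF : ProperFilter F}
  (f g : T -> R) (a b : R) :
  F (fun x => f x <= g x) ->
  filterlim f F (locally a) -> filterlim g F (locally b) -> a <= b.
Proof.
  intros H Hf Hg. exact (filterlim_le (F := F) f g a b H Hf Hg).
Qed.

Context {pos : X -> Prop} (hX : abstract_state_space X pos).

Lemma pos_Riemann_sum (f : R -> X) (ptd : SF_seq) :
  pointed_subdiv ptd ->
  (forall t, SF_h ptd <= t <= seq.last (SF_h ptd) (SF_lx ptd) -> pos (f t)) ->
  pos (Riemann_sum f ptd).
Proof.
  induction ptd as [x0|[x0 y0] ptd IH] using SF_cons_ind; intros Hp Hf.
  - apply (pos_zero _ _ hX).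
  - rewrite Riemann_sum_cons; simpl.
    assert (Hh := Hp O ltac:(unfold SF_size; simpl; lia)). simpl in Hh.
    assert (Hp' := ptd_cons _ _ Hp).
    assert (Hl : SF_h ptd <= seq.last (SF_h ptd) (SF_lx ptd)).
    { change (SF_h ptd) with (seq.head 0 (SF_lx ptd)) at 1.
      apply (sorted_last (SF_lx ptd) O); [now apply ptd_sort|simpl; lia]. }
    simpl in Hf, Hl. change (SF_h (SF_cons (x0, y0) ptd)) with x0 in *.
    apply (pos_plus _ _ hX).
    + apply (pos_scal _ _ hX); [lra|]. apply Hf. simpl. lra.
    + apply IH; [easy|]. intros t Ht. apply Hf. simpl in *. lra.
Qed.

Lemma pos_is_RInt (f : R -> X) (a b : R) (l : X) :
  a <= b -> (forall t, a <= t <= b -> pos (f t)) -> is_RInt f a b l -> pos l.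
Proof.
  intros Hab Hf H.
  apply (pos_filterlim hX (Riemann_fine a b)
    (fun ptd => scal (sign (b - a)) (Riemann_sum f ptd))); [exact H|].
  exists (mkposreal 1 Rlt_0_1). intros ptd _ (Hp & H1 & H2).
  rewrite Rmin_left in H1 by easy. rewrite Rmax_right in H2 by easy.
  apply (pos_scal _ _ hX).
  - destruct (Req_dec (b - a) 0) as [->|Hne]; [rewrite sign_0; lra|].
    rewrite sign_eq_1; lra.
  - apply pos_Riemann_sum; [easy|]. intros t. rewrite H2, H1. apply Hf.
Qed.

End Calculus.

(** * Substochastic semigroups *)

Section Semigroup.

Context {X : CompleteNormedModule R_AbsRing} {pos : X -> Prop}
  (hX : abstract_state_space X pos)
  {M : R} (HM : forall u : X, exists v w : X,
    pos v /\ pos w /\ u = minus v w /\ norm v + norm w <= M * norm u)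
  {U : R -> X -> X} (hU : C0_semigroup X U) (hUsub : substochastic X pos U)
  {DA : X -> Prop} {A : X -> X} (hA : is_generator X U DA A).

Lemma semigroup_minus (t : R) (u v : X) :
  0 <= t -> U t (minus u v) = minus (U t u) (U t v).
Proof.
  intros Ht. exact (linear_minus (U t) u v (C0_linear _ _ hU t Ht)).
Qed.

Lemma semigroup_norm_le (t : R) (u : X) :
  0 <= t -> norm (U t u) <= M * norm u.
Proof.
  intros Ht. apply (cone_bound_extends (U t) M HM).
  - intros v w. now apply semigroup_minus.
  - intros v Hv. now apply hUsub.
Qed.

Lemma filterlim_norm_sub_0 (f : R -> X) (u : X) (c : R) :
  filterlim f (at_right 0) (locally u) ->
  filterlim (fun h => c * norm (minus (f h) u)) (at_right 0) (locally 0).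
Proof.
  intros Hf. replace 0 with (c * norm (minus u u)) at 2.
  2:{ norm_to (@zero X). rewrite norm_null. ring. }
  eapply filterlim_comp;
    [|apply (filterlim_scal_r (V := R_NormedModule) c (norm (minus u u)))].
  apply norm_filterlim; [typeclasses eauto|].
  apply (filterlim_minus_fun (at_right 0)); [easy|apply filterlim_const].
Qed.

Lemma semigroup_continuous (u : X) (t : R) :
  continuous (fun t => U (Rmax 0 t) u) t.
Proof.
  apply (continuous_half_line (fun t => U t u)
    (fun h => M * norm (minus (U h u) u))).
  - apply filterlim_norm_sub_0, (C0_continuous _ _ hU).
  - intros s h Hs Hh. rewrite (C0_plus _ _ hU) by lra.
    rewrite <- semigroup_minus by easy. now apply semigroup_norm_le.
Qed.

(** * Primitives of orbits and the domain of the generator *)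

Let prim (u : X) (t : R) : X := RInt (fun r => U (Rmax 0 r) u) 0 t.

Lemma prim_is_RInt (u : X) (a b : R) :
  is_RInt (fun r => U (Rmax 0 r) u) a b (minus (prim u b) (prim u a)).
Proof.
  apply (is_RInt_value _ _ _ (plus (opp (prim u a)) (prim u b)));
    [module_eq|].
  apply (is_RInt_Chasles (V := X)) with 0.
  - refine (is_RInt_swap (V := X) _ _ _ _ _).
    apply is_RInt_continuous, semigroup_continuous.
  - apply is_RInt_continuous, semigroup_continuous.
Qed.

Lemma prim_0 (u : X) : prim u 0 = @zero X.
Proof. apply (RInt_point (V := X)). Qed.

Lemma is_derive_prim (u : X) (t : R) :
  is_derive (prim u) t (U (Rmax 0 t) u).
Proof.
  apply (is_derive_primitive (fun r => U (Rmax 0 r) u) 0 t), semigroup_continuous.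
Qed.

Lemma semigroup_prim (u : X) (s h : R) :
  0 <= s -> 0 <= h -> U s (prim u h) = minus (prim u (s + h)) (prim u s).
Proof.
  intros Hs Hh.
  assert (H1 : is_RInt (fun r => U s (U (Rmax 0 r) u)) 0 h (U s (prim u h))).
  { apply (is_RInt_linear (X := X) (Y := X) (U s));
      [now apply (C0_linear _ _ hU)|].
    apply is_RInt_continuous, semigroup_continuous. }
  assert (H2 : is_RInt (fun r => U s (U (Rmax 0 r) u)) 0 h
    (minus (prim u (s + h)) (prim u s))).
  { apply (is_RInt_ext (V := X)) with (fun r => U (Rmax 0 (s + r)) u).
    - intros r. rewrite Rmin_left, Rmax_right by easy. intros Hr.
      rewrite !Rmax_right by lra. apply (C0_plus _ _ hU); lra.
    - apply (is_RInt_shift (V := X) (fun r => U (Rmax 0 r) u)).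
      rewrite Rplus_0_r. apply prim_is_RInt. }
  apply (is_RInt_unique (V := X)) in H1, H2. congruence.
Qed.

(** By [semigroup_prim], the quotient of [U r] at [prim u h] is the difference of the quotients of
    the primitive at [h] and at [0]. *)
Lemma prim_dom (u : X) (h : R) :
  0 <= h -> DA (prim u h) /\ A (prim u h) = minus (U h u) u.
Proof.
  intros Hh. apply hA.
  assert (H : filterlim
    (fun r => minus (scal (/ r) (minus (prim u (h + r)) (prim u h)))
                (scal (/ r) (minus (prim u (0 + r)) (prim u 0))))
    (at_right 0) (locally (minus (U h u) u))).
  { apply (filterlim_minus_fun (at_right 0)).
    - replace (U h u) with (U (Rmax 0 h) u) by now rewrite Rmax_right.
      apply is_derive_quotient, is_derive_prim.
    - assert (H0 := is_derive_quotient _ _ _ (is_derive_prim u 0)).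
      now rewrite Rmax_left, (C0_zero _ _ hU) in H0 by lra. }
  revert H. apply filterlim_ext_loc.
  exists (mkposreal 1 Rlt_0_1). intros r _ Hr.
  rewrite semigroup_prim by lra.
  rewrite prim_0, Rplus_0_l, (Rplus_comm r h).
  module_eq.
Qed.

Lemma pos_prim (u : X) (h : R) : 0 <= h -> pos u -> pos (prim u h).
Proof.
  intros Hh Hu. apply (pos_is_RInt hX (fun r => U (Rmax 0 r) u) 0 h); auto.
  - intros t _. apply hUsub; [apply Rmax_l|easy].
  - apply is_RInt_continuous, semigroup_continuous.
Qed.

Lemma filterlim_prim (u : X) :
  filterlim (fun h => scal (/ h) (prim u h)) (at_right 0) (locally u).
Proof.
  assert (H := is_derive_quotient _ _ _ (is_derive_prim u 0)).
  rewrite Rmax_left, (C0_zero _ _ hU) in H by lra.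
  revert H. apply filterlim_ext. intros h.
  rewrite prim_0, Rplus_0_l. module_eq.
Qed.

Lemma generator_scal (a : R) (u : X) :
  DA u -> DA (scal a u) /\ A (scal a u) = scal a (A u).
Proof.
  intros Hu. apply hA.
  assert (H := proj1 (hA u (A u)) (conj Hu eq_refl)).
  apply (filterlim_scal_fun (at_right 0) a) in H.
  revert H. apply filterlim_ext_loc.
  exists (mkposreal 1 Rlt_0_1). intros r _ Hr.
  assert (E : U r (scal a u) = scal a (U r u))
    by (apply (linear_scal (U r) (C0_linear _ _ hU r ltac:(lra)))).
  rewrite E. module_eq.
Qed.

Lemma generator_plus (u v : X) :
  DA u -> DA v -> DA (plus u v) /\ A (plus u v) = plus (A u) (A v).
Proof.
  intros Hu Hv. apply hA.
  assert (H := filterlim_plus_fun (at_right 0) _ _ _ _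
    (proj1 (hA u (A u)) (conj Hu eq_refl))
    (proj1 (hA v (A v)) (conj Hv eq_refl))).
  revert H. apply filterlim_ext_loc.
  exists (mkposreal 1 Rlt_0_1). intros r _ Hr.
  assert (E : U r (plus u v) = plus (U r u) (U r v))
    by (apply (linear_plus (U r) (C0_linear _ _ hU r ltac:(lra)))).
  rewrite E. module_eq.
Qed.

Lemma generator_semigroup (s : R) (u : X) :
  0 <= s -> DA u -> DA (U s u) /\ A (U s u) = U s (A u).
Proof.
  intros Hs Hu. apply hA.
  assert (H := proj1 (hA u (A u)) (conj Hu eq_refl)).
  assert (HL := C0_linear _ _ hU s Hs).
  apply (linear_filterlim (Y := X) (U s) (at_right 0) _ _ HL) in H.
  revert H. apply filterlim_ext_loc.
  exists (mkposreal 1 Rlt_0_1). intros r _ Hr.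
  assert (E : U s (scal (/ r) (minus (U r u) u)) =
    scal (/ r) (U s (minus (U r u) u))) by apply (linear_scal (U s) HL).
  rewrite E, semigroup_minus by easy.
  rewrite <- !(C0_plus _ _ hU) by lra. now rewrite Rplus_comm.
Qed.

(* The approximations are the averages of U(s)u over [0,h]. *)
Lemma smooth_approximation (u : X) :
  exists z : R -> X,
    filterlim z (at_right 0) (locally u) /\
    forall h, 0 < h -> DA (z h) /\ (pos u -> pos (z h)) /\
      forall t, 0 <= t ->
        is_RInt (fun s => U s (A (z h))) 0 t (minus (U t (z h)) (z h)).
Proof.
  exists (fun h => scal (/ h) (prim u h)). split; [apply filterlim_prim|].
  intros h Hh. assert (Hi : 0 < / h) by now apply Rinv_0_lt_compat.
  destruct (prim_dom u h ltac:(lra)) as [Hd HAd].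
  destruct (generator_scal (/ h) _ Hd) as [Hsd HAsd].
  split; [easy|]. split.
  - intros Hu. apply (pos_scal _ _ hX); [lra|apply pos_prim; [lra|easy]].
  - intros t Ht. rewrite HAsd, HAd.
    (* The orbit of an average is explicit in terms of the primitive, and so is [U s (A (z h))]; the
       integral is computed by shifting intervals. *)
    pose (G := fun s => scal (/ h) (minus (prim u (s + h)) (prim u s))).
    assert (HG : forall s, 0 <= s -> U s (scal (/ h) (prim u h)) = G s).
    { intros s Hs. unfold G. rewrite <- semigroup_prim by lra.
      apply (linear_scal (U s) (C0_linear _ _ hU s Hs)). }
    assert (HG0 : scal (/ h) (prim u h) = G 0).
    { rewrite <- HG by lra. symmetry. apply (C0_zero _ _ hU). }
    rewrite HG by easy. rewrite HG0.
    apply (is_RInt_ext (V := X)) with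
      (fun s => scal (/ h) (minus (U (Rmax 0 (h + s)) u) (U (Rmax 0 s) u))).
    + intros s. rewrite Rmin_left, Rmax_right by easy. intros Hs.
      rewrite !Rmax_right by lra.
      assert (E : U s (scal (/ h) (minus (U h u) u)) =
        scal (/ h) (U s (minus (U h u) u)))
        by apply (linear_scal (U s) (C0_linear _ _ hU s ltac:(lra))).
      rewrite E, semigroup_minus, <- (C0_plus _ _ hU), Rplus_comm by lra.
      easy.
    + apply (is_RInt_value _ _ _ (scal (/ h)
        (minus (minus (prim u (h + t)) (prim u (h + 0)))
               (minus (prim u t) (prim u 0))))).
      { unfold G. rewrite !(Rplus_comm h). module_eq. }
      apply (is_RInt_scal (V := X)), (is_RInt_minus (V := X)).
      * apply (is_RInt_shift (V := X) (fun r => U (Rmax 0 r) u)).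
        apply prim_is_RInt.
      * apply prim_is_RInt.
Qed.

End Semigroup.

(** * Dyson-Phillips iterates *)

Section DysonPhillips.

Context {X : CompleteNormedModule R_AbsRing} {pos : X -> Prop}
  (hX : abstract_state_space X pos)
  {M : R} (HM : forall u : X, exists v w : X,
    pos v /\ pos w /\ u = minus v w /\ norm v + norm w <= M * norm u)
  {U : R -> X -> X} (hU : C0_semigroup X U) (hUsub : substochastic X pos U)
  {DA : X -> Prop} {A : X -> X} (hA : is_generator X U DA A)
  {Psi : X -> R} (hPsi : is_norm_functional X pos Psi)
  {B : X -> X} (hBpos : positive_on X pos DA B)
  (hAB : forall u : X, DA u -> pos u -> Psi (plus (A u) (B u)) <= 0)
  {V : nat -> R -> X -> X} (hV : dyson_phillips X U DA B V).

(** On the cone [Psi] is the norm, so the hypothesis on [A + B] says that [B] creates at most what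
    [A] dissipates. *)
Lemma norm_perturbation_le (u : X) :
  DA u -> pos u -> norm (B u) <= - Psi (A u).
Proof.
  intros Hd Hu. destruct hPsi as (HL & _ & Hn).
  rewrite <- Hn by now apply hBpos.
  assert (H := hAB u Hd Hu).
  assert (E : Psi (plus (A u) (B u)) = Psi (A u) + Psi (B u))
    by apply (linear_plus _ HL).
  lra.
Qed.

Let subconservative (n : nat) (t : R) (u : X) : Prop :=
  (forall k, (k <= n)%nat -> pos (V k t u)) /\
  sum_n (fun k => norm (V k t u)) n <= norm u.

(** [Psi] turns norms in the cone into a linear quantity, so it can be integrated through the
    recursion. The sum of [|V (S k) t x|] is the integral of the sum of [|V k (t - s) (B (U s x))|],
    at most that of [|B (U s x)|] by induction, at most that of [- Psi (A (U s x))], which is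
    [|x| - |U t x|]. The missing [|U t x|] is the term of index [0]. *)
Lemma dp_subconservative_step (n : nat) (t : R) (x : X) :
  (forall t u, 0 <= t -> pos u -> subconservative n t u) ->
  0 <= t -> DA x -> pos x ->
  is_RInt (fun s => U s (A x)) 0 t (minus (U t x) x) ->
  subconservative (S n) t x.
Proof.
  intros IH Ht Hd Hx Hint. assert (HPsi := hPsi). destruct HPsi as (HL & _ & Hn).
  pose (g := fun k s => V k (t - s) (B (U s x))).
  assert (Hg : forall k, is_RInt (g k) 0 t (V (S k) t x))
    by (intros k; now apply (dp_succ _ _ _ _ _ hV)).
  assert (HU : forall s, 0 <= s -> DA (U s x) /\ pos (U s x)).
  { intros s Hs. split; [now apply (generator_semigroup hU hA)|].
    now apply hUsub. }
  assert (Hgpos : forall k s, (k <= n)%nat -> 0 <= s <= t -> pos (g k s)).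
  { intros k s Hk Hs. destruct (HU s) as [H1 H2]; [lra|].
    apply (IH (t - s) (B (U s x))); [lra| |easy]. now apply hBpos. }
  assert (HVpos : forall k, (k <= n)%nat -> pos (V (S k) t x)).
  { intros k Hk. apply (pos_is_RInt hX (g k) 0 t); auto. }
  assert (HV0 : V O t x = U t x) by now apply (dp_zero _ _ _ _ _ hV).
  split.
  - intros [|k] Hk; [|apply HVpos; lia]. rewrite HV0. now apply hUsub.
  - rewrite sum_n_shift, HV0.
    assert (H1 : is_RInt (fun s => sum_n (fun k => Psi (g k s)) n) 0 t
      (sum_n (fun k => Psi (V (S k) t x)) n)).
    { apply (is_RInt_sum_n (V := R_NormedModule)). intros k _.
      now apply (is_RInt_linear (X := X) (Y := R_NormedModule) Psi). }
    assert (H2 : is_RInt (fun s => - Psi (U s (A x))) 0 t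
      (- Psi (minus (U t x) x))).
    { apply (is_RInt_opp (V := R_NormedModule)).
      now apply (is_RInt_linear (X := X) (Y := R_NormedModule) Psi). }
    assert (Hle := is_RInt_le _ _ _ _ _ _ Ht H1 H2).
    rewrite (sum_n_ext_loc (fun k => norm (V (S k) t x))
      (fun k => Psi (V (S k) t x))) by (intros k Hk; now rewrite Hn by auto).
    assert (E : Psi (minus (U t x) x) = norm (U t x) - norm x).
    { rewrite <- !Hn by (auto; now apply hUsub).
      apply (linear_minus Psi (U t x) x HL). }
    rewrite E in Hle. change plus with Rplus.
    enough (forall s, 0 < s < t ->
      sum_n (fun k => Psi (g k s)) n <= - Psi (U s (A x))) as Hpt.
    { specialize (Hle Hpt). lra. }
    intros s Hs. destruct (HU s) as [H3 H4]; [lra|].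
    rewrite (sum_n_ext_loc _ (fun k => norm (g k s)))
      by (intros k Hk; apply Hn, Hgpos; auto; lra).
    destruct (IH (t - s) (B (U s x))) as [_ H5]; [lra|now apply hBpos|].
    destruct (generator_semigroup hU hA s x ltac:(lra) Hd) as [_ E2].
    rewrite <- E2. eapply Rle_trans; [exact H5|].
    now apply norm_perturbation_le.
Qed.

Lemma dp_filterlim (n : nat) (t : R) {T : Type} (F : (T -> Prop) -> Prop)
  {FF : Filter F} (f : T -> X) (l : X) :
  0 <= t -> filterlim f F (locally l) ->
  filterlim (fun x => V n t (f x)) F (locally (V n t l)).
Proof.
  intros Ht. apply (linear_filterlim (Y := X) (V n t) F).
  now apply (dp_linear _ _ _ _ _ hV).
Qed.

(* The sum over k <= n of the norms is controlled by induction on n, the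
   recursion expressing the next partial sum through the previous one, and
   the loss of norm under U balancing what B creates. *)
Lemma dp_subconservative (n : nat) :
  forall (t : R) (u : X), 0 <= t -> pos u ->
  (forall k, (k <= n)%nat -> pos (V k t u)) /\
  sum_n (fun k => norm (V k t u)) n <= norm u.
Proof.
  induction n as [|n IH]; intros t u Ht Hu.
  - assert (HV0 : V O t u = U t u) by now apply (dp_zero _ _ _ _ _ hV).
    split.
    + intros k Hk. replace k with O by lia. rewrite HV0. now apply hUsub.
    + rewrite sum_O, HV0. now apply hUsub.
  - destruct (smooth_approximation hX HM hU hUsub hA u) as (z & Hz & Hz').
    assert (Hs : forall h, 0 < h -> subconservative (S n) t (z h)).
    { intros h Hh. destruct (Hz' h Hh) as (H1 & H2 & H3).
      apply dp_subconservative_step; auto. }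
    assert (Hlim : forall k, filterlim (fun h => V k t (z h)) (at_right 0)
      (locally (V k t u))) by (intros k; now apply (dp_filterlim k t (at_right 0))).
    split.
    + intros k Hk.
      apply (pos_filterlim hX (at_right 0) (fun h => V k t (z h))); auto.
      exists (mkposreal 1 Rlt_0_1). intros h _ Hh. now apply (Hs h Hh).
    + apply (filterlim_le_R (at_right 0)
        (fun h => sum_n (fun k => norm (V k t (z h))) (S n))
        (fun h => norm (z h))).
      * exists (mkposreal 1 Rlt_0_1). intros h _ Hh. now apply (Hs h Hh).
      * apply (filterlim_sum_n (V := R_NormedModule) (at_right 0)
          (fun k h => norm (V k t (z h)))).
        intros k _. now apply (norm_filterlim (at_right 0)).
      * now apply (norm_filterlim (at_right 0)).
Qed.

Lemma dp_pos (n : nat) (t : R) (u : X) : 0 <= t -> pos u -> pos (V n t u).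
Proof. intros Ht Hu. now apply (dp_subconservative n). Qed.

Lemma dp_minus (n : nat) (t : R) (u v : X) :
  0 <= t -> V n t (minus u v) = minus (V n t u) (V n t v).
Proof.
  intros Ht. exact (linear_minus (V n t) u v (dp_linear _ _ _ _ _ hV n t Ht)).
Qed.

Lemma dp_norm_le (n : nat) (t : R) (u : X) :
  0 <= t -> norm (V n t u) <= M * norm u.
Proof.
  intros Ht. apply (cone_bound_extends (V n t) M HM).
  - intros v w. now apply dp_minus.
  - intros v Hv. destruct (dp_subconservative n t v Ht Hv) as [_ H].
    eapply Rle_trans; [|exact H]. destruct n as [|n].
    + rewrite sum_O. lra.
    + rewrite sum_Sn. change plus with Rplus.
      assert (0 <= sum_n (fun k => norm (V k t v)) n); [|lra].
      eapply Rle_trans; [|apply norm_sum_n_le]. apply norm_ge_0.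
Qed.

(** * The addition formula and strong continuity *)

Lemma dp_add (n : nat) : forall (s t : R) (u : X), 0 <= s -> 0 <= t ->
  V n (t + s) u = sum_n (fun k => V k t (V (n - k)%nat s u)) n.
Proof.
  induction n as [|n IH]; intros s t u Hs Ht.
  { rewrite sum_O, !(dp_zero _ _ _ _ _ hV) by lra.
    now apply (C0_plus _ _ hU). }
  assert (Hdom : forall x, DA x ->
    V (S n) (t + s) x = sum_n (fun k => V k t (V (S n - k)%nat s x)) (S n)).
  { intros x Hx. pose (f := fun r => V n (t + s - r) (B (U r x))).
    assert (H0 : is_RInt f 0 (t + s) (V (S n) (t + s) x))
      by (apply (dp_succ _ _ _ _ _ hV); [lra|easy]).
    (* For [r <= s] the remaining time is [t + (s - r)]: the induction hypothesis splits [V n], and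
       the bounded [V k t] leave the integral. *)
    assert (H1 : is_RInt f 0 s
      (sum_n (fun k => V k t (V (S (n - k)) s x)) n)).
    { apply (is_RInt_ext (V := X)) with
        (fun r => sum_n (fun k => V k t (V (n - k)%nat (s - r) (B (U r x)))) n).
      - intros r. rewrite Rmin_left, Rmax_right by easy. intros Hr.
        rewrite <- IH by lra. unfold f.
        now replace (t + (s - r)) with (t + s - r) by ring.
      - apply (is_RInt_sum_n (V := X)). intros k Hk.
        apply (is_RInt_linear (X := X) (Y := X) (V k t));
          [now apply (dp_linear _ _ _ _ _ hV)|].
        now apply (dp_succ _ _ _ _ _ hV). }
    (* Beyond [s] the orbit restarts from [U s x]; this piece is the term [k = S n] of the sum. *)
    assert (H2 : is_RInt f s (t + s) (V (S n) t (U s x))).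
    { apply (is_RInt_ext (V := X)) with
        (fun r => V n (t - (- s + r)) (B (U (- s + r) (U s x)))).
      - intros r. rewrite Rmin_left, Rmax_right by lra. intros Hr.
        unfold f. rewrite <- (C0_plus _ _ hU) by lra.
        now replace (t - (- s + r)) with (t + s - r) by ring;
          replace (- s + r + s) with r by ring.
      - apply (is_RInt_shift (V := X) (fun r => V n (t - r) (B (U r (U s x))))).
        replace (- s + s) with 0 by ring.
        replace (- s + (t + s)) with t by ring.
        apply (dp_succ _ _ _ _ _ hV); [easy|].
        now apply (generator_semigroup hU hA). }
    assert (H3 := is_RInt_Chasles (V := X) _ _ _ _ _ _ H1 H2).
    apply (is_RInt_unique (V := X)) in H0, H3.
    rewrite <- H0, H3, sum_Sn, Nat.sub_diag, (dp_zero _ _ _ _ _ hV) by easy.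
    apply f_equal2; [|easy]. apply sum_n_ext_loc. intros k Hk.
    now rewrite Nat.sub_succ_l. }
  destruct (smooth_approximation hX HM hU hUsub hA u) as (z & Hz & Hz').
  apply (filterlim_fun_unique (at_right 0) (fun h => V (S n) (t + s) (z h))).
  - apply (dp_filterlim _ _ (at_right 0)); [lra|easy].
  - apply filterlim_ext_loc with
      (fun h => sum_n (fun k => V k t (V (S n - k)%nat s (z h))) (S n)).
    + exists (mkposreal 1 Rlt_0_1). intros h _ Hh. symmetry.
      now apply Hdom, Hz'.
    + apply (filterlim_sum_n (V := X) (at_right 0)
        (fun k h => V k t (V (S n - k)%nat s (z h)))).
      intros k _. now repeat (apply (dp_filterlim _ _ (at_right 0)); [easy|]).
Qed.

Lemma dp_at_0 (n : nat) (u : X) : V (S n) 0 u = @zero X.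
Proof.
  destruct (smooth_approximation hX HM hU hUsub hA u) as (z & Hz & Hz').
  apply (filterlim_fun_unique (at_right 0) (fun h => V (S n) 0 (z h))).
  - apply (dp_filterlim _ _ (at_right 0)); [lra|easy].
  - apply filterlim_ext_loc with (fun _ => @zero X).
    + exists (mkposreal 1 Rlt_0_1). intros h _ Hh.
      assert (H := dp_succ _ _ _ _ _ hV n 0 (z h) ltac:(lra) (proj1 (Hz' h Hh))).
      apply (is_RInt_unique (V := X)) in H. rewrite <- H.
      symmetry. apply (RInt_point (V := X)).
    + apply filterlim_const.
Qed.

(** For [v] in the cone, the bound on the sum leaves [|V (S n) h v| <= |v| - |U h v| <= |U h v -
    v|], so continuity is inherited from [U]. *)
Lemma dp_filterlim_0 (n : nat) (u : X) :
  filterlim (fun h => V n h u) (at_right 0) (locally (V n 0 u)).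
Proof.
  destruct n as [|n].
  { rewrite (dp_zero _ _ _ _ _ hV), (C0_zero _ _ hU) by lra.
    apply filterlim_ext_loc with (fun h => U h u).
    - exists (mkposreal 1 Rlt_0_1). intros h _ Hh. symmetry.
      apply (dp_zero _ _ _ _ _ hV). lra.
    - apply (C0_continuous _ _ hU). }
  rewrite dp_at_0.
  assert (Hpos : forall v, pos v ->
    filterlim (fun h => V (S n) h v) (at_right 0) (locally (@zero X))).
  { intros v Hv. apply filterlim_norm_iff; [typeclasses eauto|].
    intros eps Heps.
    assert (H := proj1 (filterlim_norm_iff _ _ _)
      (C0_continuous _ _ hU v) eps Heps).
    destruct H as [delta Hd]. exists delta. intros h Hb Hh.
    specialize (Hd h Hb Hh).
    norm_to (V (S n) h v).
    destruct (dp_subconservative (S n) h v ltac:(lra) Hv) as [_ H].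
    rewrite sum_n_shift, (dp_zero _ _ _ _ _ hV) in H by lra.
    change plus with Rplus in H.
    assert (H1 : norm (V (S n) h v) <= sum_n (fun k => norm (V (S k) h v)) n).
    { destruct n as [|n]; [rewrite sum_O; lra|]. rewrite sum_Sn.
      change plus with Rplus.
      assert (0 <= sum_n (fun k => norm (V (S k) h v)) n); [|lra].
      eapply Rle_trans; [|apply (norm_sum_n_le (fun k => V (S k) h v))].
      apply norm_ge_0. }
    assert (H2 : norm v <= norm (U h v) + norm (minus (U h v) v)).
    { replace v with (minus (U h v) (minus (U h v) v)) at 1 by module_eq.
      apply norm_sub_le. }
    lra. }
  destruct (HM u) as (v & w & Hv & Hw & -> & _).
  apply filterlim_ext_loc with (fun h => minus (V (S n) h v) (V (S n) h w)).
  - exists (mkposreal 1 Rlt_0_1). intros h _ Hh. symmetry.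
    apply dp_minus. lra.
  - apply (filterlim_value _ _ (minus zero zero)); [module_eq|].
    apply (filterlim_minus_fun (at_right 0)); auto.
Qed.

(** By [dp_add], the increment from [s] to [s + h] is a sum of [V k s] applied to increments from
    [0] to [h]; the bound [M] on [V k s] makes the modulus independent of [s]. *)
Lemma dp_continuous (n : nat) (u : X) (t : R) :
  continuous (fun t => V n (Rmax 0 t) u) t.
Proof.
  apply (continuous_half_line (fun t => V n t u)
    (fun h => sum_n (fun k =>
       M * norm (minus (V (n - k)%nat h u) (V (n - k)%nat 0 u))) n)).
  - assert (H := filterlim_sum_n (V := R_NormedModule) (at_right 0)
      (fun k h => M * norm (minus (V (n - k)%nat h u) (V (n - k)%nat 0 u)))
      (fun _ => 0) n).
    rewrite sum_n_const, Rmult_0_r in H. apply H.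
    intros k _. apply filterlim_norm_sub_0, dp_filterlim_0.
  - intros s h Hs Hh.
    assert (E : minus (V n (s + h) u) (V n s u) =
      sum_n (fun k => V k s (minus (V (n - k)%nat h u) (V (n - k)%nat 0 u))) n).
    { rewrite <- (Rplus_0_r s) at 2. rewrite !dp_add by lra.
      rewrite <- sum_n_minus. apply sum_n_ext. intros k.
      symmetry. now apply dp_minus. }
    rewrite E. eapply Rle_trans; [apply norm_sum_n_le|].
    apply sum_n_le. intros k _. now apply dp_norm_le.
Qed.

End DysonPhillips.

(** * Laplace transforms of the iterates *)

Lemma is_RInt_exp_decay (lam a b : R) :
  0 < lam ->
  is_RInt (fun s => exp (- lam * s)) a b
    ((exp (- lam * a) - exp (- lam * b)) / lam).
Proof.
  intros Hl.
  replace ((exp (- lam * a) - exp (- lam * b)) / lam) with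
    (minus (- exp (- lam * b) / lam) (- exp (- lam * a) / lam))
    by (unfold minus, plus, opp; simpl; field; lra).
  apply (is_RInt_derive (V := R_CompleteNormedModule)
    (fun s => - exp (- lam * s) / lam)).
  - intros x _. auto_derive; [easy|]. field; lra.
  - intros x _. apply (ex_derive_continuous (V := R_NormedModule)).
    auto_derive. easy.
Qed.

Lemma at_right_intro (P : R -> Prop) :
  (forall h, 0 < h -> P h) -> at_right 0 P.
Proof. intros H. exists (mkposreal 1 Rlt_0_1). intros h _ Hh. now apply H. Qed.

(** The last algebraic step of [laplace_succ], with [a = F n (L v)], [b = lam F (S n) x] and
    [c = F (S n) v]. *)
Lemma plus_minus_cancel {X : CompleteNormedModule R_AbsRing} (a b c : X) :
  plus a (minus b c) = minus b zero -> c = a.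
Proof.
  intros H. assert (E : c = minus (plus a b) (plus a (minus b c)))
    by module_eq.
  rewrite E, H. module_eq.
Qed.

Section Laplace.

Context {X : CompleteNormedModule R_AbsRing} {pos : X -> Prop}
  (hX : abstract_state_space X pos)
  {M : R} (HM0 : 0 < M) (HM : forall u : X, exists v w : X,
    pos v /\ pos w /\ u = minus v w /\ norm v + norm w <= M * norm u)
  {U : R -> X -> X} (hU : C0_semigroup X U) (hUsub : substochastic X pos U)
  {DA : X -> Prop} {A : X -> X} (hA : is_generator X U DA A)
  {Psi : X -> R} (hPsi : is_norm_functional X pos Psi)
  {B : X -> X} (hBlin : linear_on X DA B) (hBpos : positive_on X pos DA B)
  (hAB : forall u : X, DA u -> pos u -> Psi (plus (A u) (B u)) <= 0)
  {V : nat -> R -> X -> X} (hV : dyson_phillips X U DA B V)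
  {lam : R} (hlam : 0 < lam).

Let norm_le := dp_norm_le hX HM hU hUsub hA hPsi hBpos hAB hV.
Let VL (n : nat) (t : R) (Ht : 0 <= t) : is_linear (V n t) :=
  dp_linear _ _ _ _ _ hV n t Ht.

(* The integrand extended to negative times so as to be continuous. *)
Let g (n : nat) (u : X) (s : R) : X :=
  scal (exp (- lam * s)) (V n (Rmax 0 s) u).
Let G (n : nat) (u : X) (b : R) : X := RInt (g n u) 0 b.
Let F (n : nat) (u : X) : X := laplace_tail X V lam u n 0.

Lemma laplace_integrand_continuous (n : nat) (u : X) (t : R) :
  continuous (g n u) t.
Proof.
  apply (continuous_scal (V := X) (fun s => exp (- lam * s))
    (fun s => V n (Rmax 0 s) u)).
  - apply (ex_derive_continuous (V := R_NormedModule)).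
    auto_derive. easy.
  - exact (dp_continuous hX HM hU hUsub hA hPsi hBpos hAB hV n u t).
Qed.

Lemma laplace_is_RInt (n : nat) (u : X) (a b : R) :
  is_RInt (g n u) a b (minus (G n u b) (G n u a)).
Proof.
  apply (is_RInt_value _ _ _ (plus (opp (G n u a)) (G n u b)));
    [module_eq|].
  apply (is_RInt_Chasles (V := X)) with 0.
  - refine (is_RInt_swap (V := X) _ _ _ _ _).
    apply is_RInt_continuous, laplace_integrand_continuous.
  - apply is_RInt_continuous, laplace_integrand_continuous.
Qed.

Lemma laplace_0 (n : nat) (u : X) : G n u 0 = @zero X.
Proof. apply (RInt_point (V := X)). Qed.

Lemma laplace_is_RInt_0 (n : nat) (u : X) (b : R) :
  is_RInt (g n u) 0 b (G n u b).
Proof. apply is_RInt_continuous, laplace_integrand_continuous. Qed.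

Lemma laplace_norm_le (n : nat) (u : X) (a b : R) :
  0 <= a <= b ->
  norm (minus (G n u b) (G n u a)) <= M * norm u / lam * exp (- lam * a).
Proof.
  intros Hab.
  assert (HI := is_RInt_scal (V := R_NormedModule) _ _ _ (M * norm u) _
    (is_RInt_exp_decay lam a b hlam)).
  assert (H := fun Hb => norm_RInt_le (V := X) (g n u) _ a b _ _ (proj2 Hab)
    Hb (laplace_is_RInt n u a b) HI).
  eapply Rle_trans; [apply H|].
  - intros s Hs. unfold g. rewrite norm_scal_pos by (left; apply exp_pos).
    change (exp (- lam * s) * norm (V n (Rmax 0 s) u) <=
      M * norm u * exp (- lam * s)).
    rewrite Rmult_comm. apply Rmult_le_compat_r; [left; apply exp_pos|].
    apply norm_le, Rmax_l.
  - change (M * norm u * ((exp (- lam * a) - exp (- lam * b)) / lam) <=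
      M * norm u / lam * exp (- lam * a)).
    replace (M * norm u * ((exp (- lam * a) - exp (- lam * b)) / lam)) with
      (M * norm u / lam * exp (- lam * a) - M * norm u / lam * exp (- lam * b))
      by (field; lra).
    assert (0 <= M * norm u / lam * exp (- lam * b)); [|lra].
    apply Rmult_le_pos; [|left; apply exp_pos].
    apply Rmult_le_pos; [|left; now apply Rinv_0_lt_compat].
    apply Rmult_le_pos; [lra|apply norm_ge_0].
Qed.

Lemma exp_decay_small (C eps : R) :
  0 <= C -> 0 < eps ->
  exists T : R, 0 <= T /\ forall t, T <= t -> C * exp (- lam * t) < eps.
Proof.
  intros HC Heps.
  (* Chosen so that [exp (lam * t) >= 1 + lam * t > C / eps]. *)
  exists (C / eps / lam). split.
  { repeat apply Rmult_le_pos; auto; left; now apply Rinv_0_lt_compat. }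
  intros t Ht.
  assert (H : C < eps * exp (lam * t)).
  { apply Rmult_le_compat_l with (r := lam) in Ht; [|lra].
    replace (lam * (C / eps / lam)) with (C / eps) in Ht by (field; lra).
    apply Rmult_le_compat_l with (r := eps) in Ht; [|lra].
    replace (eps * (C / eps)) with C in Ht by (field; lra).
    eapply Rle_lt_trans; [exact Ht|]. apply Rmult_lt_compat_l; [easy|].
    pose proof (exp_ineq1_le (lam * t)). lra. }
  apply Rmult_lt_compat_r with (r := exp (- lam * t)) in H; [|apply exp_pos].
  eapply Rlt_le_trans; [exact H|].
  rewrite Rmult_assoc, <- exp_plus.
  replace (lam * t + - lam * t) with 0 by ring. rewrite exp_0. lra.
Qed.

Lemma laplace_ex_lim (n : nat) (u : X) :
  exists l : X, filterlim (G n u) (Rbar_locally p_infty) (locally l).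
Proof.
  apply (filterlim_locally_cauchy (U := X) (F := Rbar_locally p_infty)).
  intros eps.
  assert (HC : 0 <= M * norm u / lam).
  { apply Rmult_le_pos; [|left; now apply Rinv_0_lt_compat].
    apply Rmult_le_pos; [lra|apply norm_ge_0]. }
  destruct (exp_decay_small _ eps HC (cond_pos eps)) as (T & HT0 & HT).
  exists (fun b => T < b). split; [now exists T|].
  assert (Hmain : forall a b, T < a <= b ->
    norm (minus (G n u b) (G n u a)) < eps).
  { intros a b Hab. eapply Rle_lt_trans; [apply laplace_norm_le; lra|].
    apply HT; lra. }
  intros a b Ha Hb. apply (norm_compat1 (V := X)).
  destruct (Rle_dec a b); [apply Hmain; lra|].
  change (norm (minus (G n u b) (G n u a)) < eps).
  rewrite norm_sub_sym. apply Hmain; lra.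
Qed.

Lemma laplace_is_RInt_gen (n : nat) (u l : X) (t : R) :
  0 <= t -> filterlim (G n u) (Rbar_locally p_infty) (locally l) ->
  is_RInt_gen (laplace_integrand X V lam u n) (at_point t)
    (Rbar_locally p_infty) (minus l (G n u t)).
Proof.
  intros Ht Hl P HP.
  assert (H : filterlim (fun b => minus (G n u b) (G n u t))
    (Rbar_locally p_infty) (locally (minus l (G n u t)))).
  { apply (filterlim_minus_fun (Rbar_locally p_infty)); [easy|].
    apply filterlim_const. }
  (* The endpoint [b] is taken beyond [t] because the integrand and its extension [g] are known to
     agree only at nonnegative times. *)
  apply Filter_prod with (fun a => a = t)
    (fun b => t < b /\ P (minus (G n u b) (G n u t))).
  - easy.
  - apply filter_and; [now exists t|now apply H].
  - intros a b -> [Hb HPb]. exists (minus (G n u b) (G n u t)).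
    split; [|easy]. simpl.
    apply (is_RInt_ext (V := X)) with (g n u); [|apply laplace_is_RInt].
    intros s. rewrite Rmin_left, Rmax_right by lra. intros Hs.
    unfold g, laplace_integrand. now rewrite Rmax_right by lra.
Qed.

Lemma laplace_filterlim (n : nat) (u : X) :
  filterlim (G n u) (Rbar_locally p_infty) (locally (F n u)).
Proof.
  destruct (laplace_ex_lim n u) as [l Hl].
  assert (E : F n u = l).
  { assert (H := laplace_is_RInt_gen n u l 0 (Rle_refl 0) Hl).
    apply (is_RInt_gen_unique (V := X)) in H. unfold F, laplace_tail.
    rewrite H, laplace_0. module_eq. }
  now rewrite E.
Qed.

Lemma laplace_tail_correct (n : nat) (u : X) (t : R) :
  0 <= t ->
  ex_RInt_gen (laplace_integrand X V lam u n) (at_point t)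
    (Rbar_locally p_infty) /\
  laplace_tail X V lam u n t = minus (F n u) (G n u t).
Proof.
  intros Ht.
  assert (H := laplace_is_RInt_gen n u _ t Ht (laplace_filterlim n u)).
  split; [now exists (minus (F n u) (G n u t))|].
  now apply (is_RInt_gen_unique (V := X)) in H.
Qed.

Lemma filterlim_p_infty_intro (f h : R -> X) (l : X) :
  (forall b, 0 <= b -> f b = h b) ->
  filterlim f (Rbar_locally p_infty) (locally l) ->
  filterlim h (Rbar_locally p_infty) (locally l).
Proof.
  intros H. apply filterlim_ext_loc. exists 0. intros b Hb. apply H. lra.
Qed.

(** Serves twice: with a scalar multiplication, for the homogeneity of [F n], and with [U t], for
    its commutation with the resolvent. *)
Lemma laplace_bounded_linear (T : X -> X) (n : nat) (u : X) :
  is_linear T -> (forall s, 0 <= s -> T (V n s u) = V n s (T u)) ->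
  T (F n u) = F n (T u).
Proof.
  intros HT Hc.
  apply (filterlim_fun_unique (Rbar_locally p_infty) (G n (T u)));
    [|apply laplace_filterlim].
  apply filterlim_p_infty_intro with (fun b => T (G n u b)).
  - intros b Hb.
    assert (H := is_RInt_linear (X := X) (Y := X) T _ _ _ _ HT
      (laplace_is_RInt_0 n u b)).
    apply (is_RInt_unique (V := X)) in H. rewrite <- H.
    apply (RInt_ext (V := X)). intros s _. unfold g.
    rewrite <- Hc by apply Rmax_l. apply (linear_scal T HT).
  - apply (linear_filterlim (Y := X) T (Rbar_locally p_infty)); [easy|].
    apply laplace_filterlim.
Qed.

Lemma laplace_linear (n : nat) : is_linear (F n).
Proof.
  split.
  - intros u v.
    apply (filterlim_fun_unique (Rbar_locally p_infty) (G n (plus u v)));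
      [apply laplace_filterlim|].
    apply filterlim_p_infty_intro with (fun b => plus (G n u b) (G n v b)).
    + intros b Hb.
      assert (H := is_RInt_plus (V := X) _ _ _ _ _ _
        (laplace_is_RInt_0 n u b) (laplace_is_RInt_0 n v b)).
      apply (is_RInt_unique (V := X)) in H.
      etransitivity; [symmetry; exact H|].
      apply (RInt_ext (V := X)). intros s _. unfold g.
      assert (E := linear_plus _ (VL n _ (Rmax_l 0 s)) u v).
      symmetry. etransitivity; [apply f_equal, E|]. module_eq.
    + apply (filterlim_plus_fun (Rbar_locally p_infty));
        apply laplace_filterlim.
  - intros a u. symmetry.
    apply (laplace_bounded_linear (fun x => scal a x)).
    + apply (is_linear_scal_r (V := X) a). intros x y. apply Rmult_comm.
    + intros s Hs. symmetry. apply (linear_scal _ (VL n s Hs)).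
  - exists (M / lam). split; [now apply Rdiv_lt_0_compat|]. intros u.
    apply (norm_le_filterlim (Rbar_locally p_infty) (G n u));
      [apply laplace_filterlim|].
    exists 0. intros b Hb.
    assert (H := laplace_norm_le n u 0 b ltac:(lra)).
    rewrite Rmult_0_r, exp_0 in H.
    assert (E : G n u b = minus (G n u b) (G n u 0))
      by (rewrite laplace_0; module_eq).
    rewrite E.
    replace (M / lam * norm u) with (M * norm u / lam * 1) by (field; lra).
    exact H.
Qed.

Lemma laplace_pos (n : nat) (u : X) : pos u -> pos (F n u).
Proof.
  intros Hu. apply (pos_filterlim hX (Rbar_locally p_infty) (G n u));
    [apply laplace_filterlim|].
  exists 0. intros b Hb.
  apply (pos_is_RInt hX (g n u) 0 b); [lra| |apply laplace_is_RInt_0].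
  intros s _. apply (pos_scal _ _ hX); [left; apply exp_pos|].
  now apply (dp_pos hX HM hU hUsub hA hPsi hBpos hAB hV); [apply Rmax_l|].
Qed.

Lemma laplace_tail_sum (n : nat) (u : X) (t : R) :
  0 <= t ->
  laplace_tail X V lam u n t =
    scal (exp (- lam * t)) (sum_n (fun k => F k (V (n - k)%nat t u)) n).
Proof.
  intros Ht. rewrite (proj2 (laplace_tail_correct n u t Ht)).
  (* The tail is the limit of the integrals over [[t,t+b]]; shifted to [[0,b]], their integrand
     splits by [dp_add] into finitely many terms. *)
  apply (filterlim_fun_unique (Rbar_locally p_infty)
    (fun b => minus (G n u (t + b)) (G n u t))).
  - apply (filterlim_minus_fun (Rbar_locally p_infty));
      [|apply filterlim_const].
    apply (filterlim_comp _ _ _ (fun b => t + b) (G n u) _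
      (Rbar_locally p_infty)); [|apply laplace_filterlim].
    intros P [N HN]. exists (N - t). intros b Hb. apply HN. lra.
  - apply filterlim_p_infty_intro with (fun b =>
      scal (exp (- lam * t)) (sum_n (fun k => G k (V (n - k)%nat t u) b) n)).
    + intros b Hb.
      assert (H1 := is_RInt_scal (V := X) _ _ _ (exp (- lam * t)) _
        (is_RInt_sum_n (V := X) (fun k => g k (V (n - k)%nat t u)) 0 b _ n
          (fun k _ => laplace_is_RInt_0 k (V (n - k)%nat t u) b))).
      assert (H2 : is_RInt (fun r => g n u (t + r)) 0 b
        (minus (G n u (t + b)) (G n u t))).
      { apply (is_RInt_shift (V := X)). rewrite Rplus_0_r.
        apply laplace_is_RInt. }
      apply (is_RInt_unique (V := X)) in H1, H2.
      rewrite <- H2. etransitivity; [symmetry; exact H1|].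
      apply (RInt_ext (V := X)). intros s.
      rewrite Rmin_left, Rmax_right by easy. intros Hs. unfold g.
      rewrite !Rmax_right by lra. rewrite Rplus_comm.
      rewrite (dp_add hX HM hU hUsub hA hV) by lra.
      rewrite (sum_n_scal_l (K := R_Ring) (V := X)).
      replace (- lam * (s + t)) with (- lam * t + - lam * s) by ring.
      rewrite exp_plus. apply (scal_assoc (K := R_Ring) (V := X)).
    + apply (filterlim_scal_fun (Rbar_locally p_infty)).
      apply (filterlim_sum_n (V := X) (Rbar_locally p_infty)
        (fun k b => G k (V (n - k)%nat t u) b)).
      intros k _. apply laplace_filterlim.
Qed.

Lemma laplace_sum_at_0 (n : nat) (u : X) :
  sum_n (fun k => F k (V (n - k)%nat 0 u)) n = F n u.
Proof.
  unfold F at 2. rewrite laplace_tail_sum by lra.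
  rewrite Rmult_0_r, exp_0. symmetry. apply (scal_one (K := R_Ring) (V := X)).
Qed.

(** By [laplace_tail_sum] the sum is [exp (lam * h)] times the tail at [h], that is
    [exp (lam * h) (F n u - G n u h)]; the terms of the limit are the derivatives at [0] of the
    exponential and of [G n u]. Index [0] yields the resolvent equation, and positive indices yield
    [laplace_succ]. *)
Lemma laplace_quotient (n : nat) (u : X) :
  filterlim (fun h => scal (/ h)
      (minus (sum_n (fun k => F k (V (n - k)%nat h u)) n) (F n u)))
    (at_right 0) (locally (minus (scal lam (F n u)) (V n 0 u))).
Proof.
  assert (He : filterlim (fun h => / h * (exp (lam * h) - 1)) (at_right 0)
    (locally lam)).
  { assert (H : is_derive (fun h => exp (lam * h)) 0 lam).
    { auto_derive; [easy|]. rewrite Rmult_0_r, exp_0. ring. }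
    apply (is_derive_quotient (X := R_CompleteNormedModule)) in H.
    revert H. apply filterlim_ext. intros h.
    rewrite Rmult_0_r, exp_0, Rplus_0_l. easy. }
  assert (He1 : filterlim (fun h => exp (lam * h)) (at_right 0) (locally 1)).
  { assert (H : continuous (fun h => exp (lam * h)) 0).
    { apply (ex_derive_continuous (V := R_NormedModule)). auto_derive. easy. }
    unfold continuous in H. rewrite Rmult_0_r, exp_0 in H.
    exact (filterlim_filter_le_1 (F := locally 0) _ (filter_le_within _) H). }
  assert (HG : filterlim (fun h => scal (/ h) (G n u h)) (at_right 0)
    (locally (V n 0 u))).
  { assert (H := is_derive_quotient _ _ _
      (is_derive_primitive (g n u) 0 0 (laplace_integrand_continuous n u))).
    apply (filterlim_value _ _ (g n u 0)).
    - unfold g. rewrite Rmax_left, Rmult_0_r, exp_0 by lra.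
      apply (scal_one (K := R_Ring) (V := X)).
    - revert H. apply filterlim_ext. intros h. rewrite Rplus_0_l.
      change (scal (/ h) (minus (G n u h) (G n u 0)) = scal (/ h) (G n u h)).
      rewrite laplace_0. module_eq. }
  assert (H : filterlim (fun h =>
      minus (scal (/ h * (exp (lam * h) - 1)) (F n u))
            (scal (exp (lam * h)) (scal (/ h) (G n u h))))
    (at_right 0) (locally (minus (scal lam (F n u)) (scal 1 (V n 0 u))))).
  { apply (filterlim_minus_fun (at_right 0)).
    - apply (filterlim_comp _ _ _ _ (fun z => scal z (F n u)) _ _ _ He).
      apply (filterlim_scal_l (V := X) lam (F n u)).
    - apply (filterlim_comp_2 _ _ (fun z w => scal z w) He1 HG).
      apply (filterlim_scal (V := X) 1 (V n 0 u)). }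
  apply (filterlim_value _ _ _ (minus (scal lam (F n u)) (V n 0 u))) in H;
    [|module_eq].
  revert H. apply filterlim_ext_loc, at_right_intro. intros h Hh.
  assert (E : sum_n (fun k => F k (V (n - k)%nat h u)) n =
    scal (exp (lam * h)) (minus (F n u) (G n u h))).
  { rewrite <- (proj2 (laplace_tail_correct n u h ltac:(lra))).
    rewrite laplace_tail_sum by lra.
    etransitivity; [|symmetry; apply (scal_assoc (K := R_Ring) (V := X))].
    change (mult (exp (lam * h)) (exp (- lam * h))) with
      (exp (lam * h) * exp (- lam * h)).
    rewrite <- exp_plus. replace (lam * h + - lam * h) with 0 by ring.
    rewrite exp_0. symmetry. apply (scal_one (K := R_Ring) (V := X)). }
  rewrite E. module_eq.
Qed.

(** * The resolvent of [A] and the operator [L] *)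

Let VO (t : R) (u : X) (Ht : 0 <= t) : V O t u = U t u :=
  dp_zero _ _ _ _ _ hV t u Ht.

Lemma resolvent_commute (t : R) (v : X) :
  0 <= t -> U t (F O v) = F O (U t v).
Proof.
  intros Ht.
  apply (laplace_bounded_linear (U t)); [now apply (C0_linear _ _ hU)|].
  intros s Hs. rewrite !VO by easy.
  rewrite <- !(C0_plus _ _ hU) by easy. now rewrite Rplus_comm.
Qed.

Lemma resolvent_dom (v : X) :
  DA (F O v) /\ A (F O v) = minus (scal lam (F O v)) v.
Proof.
  apply hA. assert (H := laplace_quotient O v).
  rewrite VO, (C0_zero _ _ hU) in H by lra.
  revert H. apply filterlim_ext_loc, at_right_intro. intros h Hh.
  rewrite sum_O. simpl. rewrite VO by lra.
  now rewrite resolvent_commute by lra.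
Qed.

Let L (v : X) : X := B (F O v).

Lemma perturbed_resolvent_pos (v : X) : pos v -> pos (L v).
Proof.
  intros Hv. apply hBpos; [apply resolvent_dom|now apply laplace_pos].
Qed.

(** With [R = F O], [A R v = lam R v - v] gives [|L v| <= - Psi (A R v) = |v| - lam Psi (R v)], and
    [Psi (R v)] is nonnegative. *)
Lemma perturbed_resolvent_norm_le (v : X) : pos v -> norm (L v) <= norm v.
Proof.
  intros Hv. destruct (resolvent_dom v) as [Hd HAd].
  assert (HR := laplace_pos O v Hv).
  eapply Rle_trans;
    [now apply (norm_perturbation_le hPsi hBpos hAB); [exact Hd|]|].
  assert (HPsi := hPsi). destruct HPsi as (HL & Hp & Hn). rewrite HAd.
  assert (E1 : Psi (minus (scal lam (F O v)) v) =
    Psi (scal lam (F O v)) - Psi v) by apply (linear_minus Psi _ _ HL).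
  assert (E2 : Psi (scal lam (F O v)) = lam * Psi (F O v))
    by apply (linear_scal Psi HL).
  rewrite E1, E2, (Hn v Hv). specialize (Hp _ HR).
  assert (0 <= lam * Psi (F O v)) by (apply Rmult_le_pos; lra). lra.
Qed.

Lemma perturbation_minus (u v : X) :
  DA u -> DA v -> B (minus u v) = minus (B u) (B v).
Proof.
  intros Hu Hv. destruct hBlin as [Hp Hs].
  destruct (generator_scal hU hA (-1) v Hv) as [Hv' _].
  assert (E : minus u v = plus u (scal (-1) v)) by module_eq.
  rewrite E, Hp, Hs by easy. module_eq.
Qed.

Lemma perturbed_resolvent_linear : is_linear L.
Proof.
  destruct hBlin as [Hp Hs]. split.
  - intros u v. unfold L.
    assert (E : F O (plus u v) = plus (F O u) (F O v))
      by apply (linear_plus _ (laplace_linear O)).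
    etransitivity; [apply f_equal, E|]. apply Hp; apply resolvent_dom.
  - intros a u. unfold L.
    assert (E : F O (scal a u) = scal a (F O u))
      by apply (linear_scal _ (laplace_linear O)).
    etransitivity; [apply f_equal, E|]. apply Hs; apply resolvent_dom.
  (* Continuity comes from contractivity on the cone, not from any bound on [B]. *)
  - exists M. split; [easy|].
    apply (cone_bound_extends L M HM); [|apply perturbed_resolvent_norm_le].
    intros u v. unfold L.
    assert (E : F O (minus u v) = minus (F O u) (F O v))
      by apply (linear_minus _ _ _ (laplace_linear O)).
    rewrite E. apply perturbation_minus; apply resolvent_dom.
Qed.

(** Since [U s] commutes with the resolvent, the recursion at [F O v] has the integrand
    [V n (h - s) (L (U s v))]. Continuity of [L] makes it tend to [V n 0 (L v)] uniformly over
    [[0,h]], and the quotient is its average. *)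
Lemma dp_quotient (n : nat) (v : X) :
  filterlim (fun h => scal (/ h) (V (S n) h (F O v))) (at_right 0)
    (locally (V n 0 (L v))).
Proof.
  apply filterlim_norm_iff; [typeclasses eauto|]. intros eps Heps.
  assert (He : 0 < eps / 4) by lra.
  assert (HeM : 0 < eps / 4 / M) by now apply Rdiv_lt_0_compat.
  assert (H1 := proj1 (filterlim_norm_iff (at_right 0) _ _)
    (dp_filterlim_0 hX HM hU hUsub hA hPsi hBpos hAB hV n (L v)) _ He).
  assert (H2 := proj1 (filterlim_norm_iff (at_right 0) _ _)
    (linear_filterlim (Y := X) L (at_right 0) _ _ perturbed_resolvent_linear
      (C0_continuous _ _ hU v)) _ HeM).
  assert (Hzero : forall x : X, norm (minus x x) = 0).
  { intros x. norm_to (@zero X). apply norm_null. }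
  destruct (filter_and _ _ H1 H2) as [delta Hd].
  (* The filter [at_right 0] ignores [0], which both [s] and [h - s] reach at an endpoint of the
     integral. *)
  assert (Hd' : forall s, 0 <= s < delta ->
    norm (minus (V n s (L v)) (V n 0 (L v))) < eps / 4 /\
    norm (minus (L (U s v)) (L v)) < eps / 4 / M).
  { intros s Hs. destruct (Req_dec s 0) as [->|Hs0].
    - rewrite (C0_zero _ _ hU), !Hzero. lra.
    - apply Hd; [|lra]. change (Rabs (s - 0) < delta).
      rewrite Rminus_0_r, Rabs_pos_eq; lra. }
  exists delta. intros h Hb Hh. change (Rabs (h - 0) < delta) in Hb.
  change R in (type of h).
  rewrite Rminus_0_r, Rabs_pos_eq in Hb by lra.
  assert (HI : is_RInt (fun s => minus (V n (h - s) (B (U s (F O v))))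
      (V n 0 (L v))) 0 h
    (minus (V (S n) h (F O v)) (scal (h - 0) (V n 0 (L v))))).
  { apply (is_RInt_minus (V := X)); [|apply (is_RInt_const (V := X))].
    apply (dp_succ _ _ _ _ _ hV); [lra|apply resolvent_dom]. }
  assert (HN := fun Hb => norm_RInt_le_const (V := X) _ 0 h _ (eps / 2) ltac:(lra)
    Hb HI).
  rewrite Rminus_0_r in HN.
  norm_to_with (scal (/ h) (minus (V (S n) h (F O v)) (scal h (V n 0 (L v)))))
    ltac:(try (field; lra)).
  assert (Hi : 0 < / h) by now apply Rinv_0_lt_compat.
  rewrite norm_scal_pos by lra.
  apply Rle_lt_trans with (/ h * (h * (eps / 2))).
  - apply Rmult_le_compat_l; [lra|]. apply HN. intros s Hs.
    rewrite resolvent_commute by lra. fold (L (U s v)).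
    destruct (Hd' s) as [_ H3]; [lra|].
    destruct (Hd' (h - s)) as [H4 _]; [lra|].
    eapply Rle_trans;
      [apply (norm_sub_triangle _ (V n (h - s) (L v)))|].
    rewrite <- (dp_minus hV) by lra.
    assert (H5 := norm_le n (h - s) (minus (L (U s v)) (L v)) ltac:(lra)).
    apply Rmult_lt_compat_l with (r := M) in H3; [|easy].
    replace (M * (eps / 4 / M)) with (eps / 4) in H3 by (field; lra). lra.
  - replace (/ h * (h * (eps / 2))) with (eps / 2) by (field; lra). lra.
Qed.

(* Differentiate at t = 0 the formula of [laplace_tail_sum], for u in the
   domain: this replaces an exchange of integrals. *)
Lemma laplace_succ (n : nat) (v : X) : F (S n) v = F n (L v).
Proof.
  set (x := F O v). destruct (resolvent_dom v) as [Hd HAd]. fold x in Hd, HAd.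
  assert (H1 := laplace_quotient (S n) x).
  rewrite (dp_at_0 hX HM hU hUsub hA hV) in H1.
  assert (HL := laplace_linear).
  (* The term [k = S n] contains [V O = U] and produces the generator; in every other term an
     iterate of positive index acts on [x = F O v], as [dp_quotient] requires. *)
  assert (H2 : filterlim (fun h =>
      plus (sum_n (fun k => F k (scal (/ h) (V (S (n - k)) h x))) n)
        (F (S n) (scal (/ h) (minus (U h x) x))))
    (at_right 0)
    (locally (plus (sum_n (fun k => F k (V (n - k)%nat 0 (L v))) n)
                (F (S n) (A x))))).
  { apply (filterlim_plus_fun (at_right 0)).
    - apply (filterlim_sum_n (V := X) (at_right 0)
        (fun k h => F k (scal (/ h) (V (S (n - k)) h x)))).
      intros k _. apply (linear_filterlim (Y := X) (F k) (at_right 0));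
        [apply HL|apply dp_quotient].
    - apply (linear_filterlim (Y := X) (F (S n)) (at_right 0)); [apply HL|].
      now apply hA. }
  assert (E : plus (sum_n (fun k => F k (V (n - k)%nat 0 (L v))) n)
      (F (S n) (A x)) = minus (scal lam (F (S n) x)) zero).
  { apply (filterlim_fun_unique (at_right 0) _ _ _ H2). revert H1.
    apply filterlim_ext_loc, at_right_intro. intros h Hh.
    rewrite sum_Sn, Nat.sub_diag, VO by lra.
    assert (E1 : F (S n) (scal (/ h) (minus (U h x) x)) =
      scal (/ h) (minus (F (S n) (U h x)) (F (S n) x))).
    { etransitivity; [apply (linear_scal _ (HL (S n)))|].
      apply f_equal, (linear_minus _ _ _ (HL (S n))). }
    rewrite E1.
    rewrite (sum_n_ext_loc (fun k => F k (V (S n - k)%nat h x))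
      (fun k => F k (V (S (n - k)) h x)))
      by (intros k Hk; now rewrite Nat.sub_succ_l).
    assert (E2 : sum_n (fun k => F k (scal (/ h) (V (S (n - k)) h x))) n =
      scal (/ h) (sum_n (fun k => F k (V (S (n - k)) h x)) n)).
    { rewrite <- (sum_n_scal_l (K := R_Ring) (V := X)).
      apply sum_n_ext. intros k. apply (linear_scal _ (HL k)). }
    rewrite E2. module_eq. }
  (* At time [0] the sum collapses to [F n (L v)], and [A x = lam x - v]; the two terms
     [lam F (S n) x] then cancel. *)
  rewrite laplace_sum_at_0, HAd in E.
  assert (E3 : F (S n) (minus (scal lam x) v) =
    minus (scal lam (F (S n) x)) (F (S n) v)).
  { etransitivity; [apply (linear_minus _ _ _ (HL (S n)))|].
    apply f_equal2; [apply (linear_scal _ (HL (S n)))|easy]. }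
  rewrite E3 in E.
  now apply plus_minus_cancel in E.
Qed.

Lemma laplace_iter (n : nat) : forall v : X, F n v = F O (Nat.iter n L v).
Proof.
  induction n as [|n IH]; intros v; [easy|].
  now rewrite laplace_succ, IH, Nat.iter_succ_r.
Qed.

Lemma laplace_dom (n : nat) (v : X) : DA (F n v).
Proof. rewrite laplace_iter. apply resolvent_dom. Qed.

Lemma perturbation_laplace_norm_le (n : nat) (v : X) :
  pos v -> norm (B (F n v)) <= norm v.
Proof.
  intros Hv. rewrite laplace_iter. fold (L (Nat.iter n L v)).
  assert (H : pos (Nat.iter n L v) /\ norm (Nat.iter n L v) <= norm v).
  { induction n as [|n [IH1 IH2]]; simpl; [split; [easy|lra]|]. split.
    - now apply perturbed_resolvent_pos.
    - eapply Rle_trans; [now apply perturbed_resolvent_norm_le|easy]. }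
  eapply Rle_trans; [now apply perturbed_resolvent_norm_le|easy].
Qed.

(** * The image of the tail under [B] *)

Lemma perturbation_sum_n (a : nat -> X) (n : nat) :
  (forall k, DA (a k)) ->
  DA (sum_n a n) /\ B (sum_n a n) = sum_n (fun k => B (a k)) n.
Proof.
  intros Ha. destruct hBlin as [Hp _].
  induction n as [|n [IH1 IH2]].
  - rewrite !sum_O. now split.
  - rewrite !sum_Sn, <- IH2. split; [|now apply Hp].
    now apply (generator_plus hU hA).
Qed.

Lemma laplace_tail_dom (n : nat) (u : X) (t : R) :
  0 <= t -> DA (laplace_tail X V lam u n t).
Proof.
  intros Ht. rewrite laplace_tail_sum by easy.
  apply (generator_scal hU hA), perturbation_sum_n.
  intros k. apply laplace_dom.
Qed.

Lemma perturbation_tail_pos_norm_le (n : nat) (u : X) (t : R) :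
  0 <= t -> pos u ->
  norm (B (laplace_tail X V lam u n t)) <= exp (- lam * t) * norm u.
Proof.
  intros Ht Hu. rewrite laplace_tail_sum by easy.
  destruct (perturbation_sum_n (fun k => F k (V (n - k)%nat t u)) n) as [Hd E];
    [intros k; apply laplace_dom|].
  destruct hBlin as [_ Hs].
  assert (E1 := Hs (exp (- lam * t)) _ Hd). rewrite E1, E.
  assert (He := exp_pos (- lam * t)).
  rewrite norm_scal_pos by lra. apply Rmult_le_compat_l; [lra|].
  eapply Rle_trans; [apply norm_sum_n_le|].
  eapply Rle_trans; [|now apply
    (dp_subconservative hX HM hU hUsub hA hPsi hBpos hAB hV n t u)].
  (* The term of index [k] is bounded by the norm of [V (n - k) t u], so the known sum is read
     backwards. *)
  rewrite <- (sum_n_rev (fun k => norm (V k t u))).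
  apply sum_n_le. intros k _. apply perturbation_laplace_norm_le.
  now apply (dp_pos hX HM hU hUsub hA hPsi hBpos hAB hV).
Qed.

Lemma perturbation_tail_norm_le (n : nat) (u : X) (t : R) :
  0 <= t ->
  norm (B (laplace_tail X V lam u n t)) <= M * norm u * exp (- lam * t).
Proof.
  intros Ht.
  rewrite Rmult_comm, <- Rmult_assoc, (Rmult_comm _ M), Rmult_assoc.
  destruct (HM u) as (v & w & Hv & Hw & Hu & Hn).
  assert (E : laplace_tail X V lam u n t =
    minus (laplace_tail X V lam v n t) (laplace_tail X V lam w n t)).
  { rewrite !laplace_tail_sum by easy.
    etransitivity; [|apply (scal_minus_distr_l (K := R_Ring) (V := X))].
    apply f_equal. etransitivity; [|apply sum_n_minus].
    apply sum_n_ext. intros k. rewrite Hu, (dp_minus hV) by easy.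
    apply (linear_minus _ _ _ (laplace_linear k)). }
  rewrite E, perturbation_minus by now apply laplace_tail_dom.
  eapply Rle_trans; [apply norm_sub_le|].
  assert (H1 := perturbation_tail_pos_norm_le n v t Ht Hv).
  assert (H2 := perturbation_tail_pos_norm_le n w t Ht Hw).
  assert (He := exp_pos (- lam * t)).
  apply Rmult_le_compat_l with (r := exp (- lam * t)) in Hn; lra.
Qed.

End Laplace.

(** [real] sends infinite values to [0], so a bound on [real] of a supremum is meaningful only
    together with finiteness. *)
Lemma Sup_seq_bounds (a : nat -> R) (C : R) :
  (forall n, 0 <= a n <= C) ->
  is_finite (Sup_seq (fun n => Finite (a n))) /\
  0 <= real (Sup_seq (fun n => Finite (a n))) <= C.
Proof.
  intros Ha.
  assert (H1 : Rbar_le 0 (Sup_seq (fun n => Finite (a n)))).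
  { apply (Sup_seq_minor_le _ 0 O). apply (Ha O). }
  assert (H2 : Rbar_le (Sup_seq (fun n => Finite (a n))) C).
  { apply Rbar_not_lt_le. intros H.
    apply Sup_seq_minor_lt in H. destruct H as [n Hn].
    specialize (Ha n). simpl in Hn. lra. }
  destruct (Sup_seq (fun n => Finite (a n))) as [r| |]; simpl in *; easy.
Qed.

Theorem proposition4p4
  (X : CompleteNormedModule R_AbsRing) (pos : X -> Prop) (Psi : X -> R)
  (hX : abstract_state_space X pos)
  (hPsi : is_norm_functional X pos Psi)
  (U : R -> X -> X)
  (hU : C0_semigroup X U)
  (hUsub : substochastic X pos U)
  (DA : X -> Prop) (A : X -> X)
  (hA : is_generator X U DA A)
  (B : X -> X)
  (hBlin : linear_on X DA B)
  (hBpos : positive_on X pos DA B)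
  (hAB : forall u : X, DA u -> pos u -> Psi (plus (A u) (B u)) <= 0)
  (V : nat -> R -> X -> X)
  (hV : dyson_phillips X U DA B V)
  (lam : R) (hlam : 0 < lam) (u : X) :
  (* the integrals converge and lie in the domain of B *)
  (forall (n : nat) (t : R), 0 <= t ->
     ex_RInt_gen (laplace_integrand X V lam u n)
       (at_point t) (Rbar_locally p_infty) /\
     DA (laplace_tail X V lam u n t)) /\
  (* the supremum, taken in Rbar, is finite for large t and tends to 0 *)
  Rbar_locally' p_infty (fun t : R =>
    is_finite (Sup_seq (fun n : nat =>
      Finite (norm (B (laplace_tail X V lam u n t)))))) /\
  is_lim (fun t : R =>
    real (Sup_seq (fun n : nat =>
      Finite (norm (B (laplace_tail X V lam u n t)))))) p_infty 0.
Proof.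
  destruct (bounded_decomposition hX) as (M & HM0 & HM).
  assert (Hb := fun n t => perturbation_tail_norm_le hX HM0 HM hU hUsub hA hPsi
    hBlin hBpos hAB hV hlam n u t).
  assert (Hsup := fun t (Ht : 0 <= t) => Sup_seq_bounds
    (fun n => norm (B (laplace_tail X V lam u n t))) _
    (fun n => conj (norm_ge_0 _) (Hb n t Ht))).
  split; [|split].
  - intros n t Ht. split.
    + now apply (laplace_tail_correct hX HM0 HM hU hUsub hA hPsi hBpos hAB hV hlam).
    + now apply (laplace_tail_dom hX HM0 HM hU hUsub hA hPsi hBlin hBpos hAB hV hlam).
  - exists 0. intros t Ht. apply Hsup. lra.
  - apply is_lim_spec. intros eps.
    destruct (exp_decay_small hlam (M * norm u) eps) as (T & HT0 & HT).
    + apply Rmult_le_pos; [lra|apply norm_ge_0].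
    + apply cond_pos.
    + exists T. intros t Ht. destruct (Hsup t) as [_ H]; [lra|].
      rewrite Rminus_0_r, Rabs_pos_eq by apply H.
      eapply Rle_lt_trans; [apply H|apply HT; lra].
Qed.
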